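(* For $t$ in the open unit disk $\mathbb D$ and $z\in\mathbf V(\Lambda)$, let $$e_t(z)=\prod_{k=1}^N\frac{2+t(1+z_k-z_{k-1})}{2+t(1+z_{k-1}-z_k)},$$ where $(z_0,\dots,z_N)$ is any path in $\Lambda$ from $z_0=0$ to $z_N=z$ (and $e_t(0)=1$), and consider the Taylor expansion $$e_t(z)=\sum_{n=0}^\infty t^nz^{(n)},\qquad t\in\mathbb D,\ z\in\mathbf V(\Lambda).$$ The Taylor coefficients $z^{(n)}$ are DA functions of $z$ with the following properties: $$z^{(0)}=1\quad\text{and}\quad z^{(n)}=Z_+z^{(n-1)},\quad n\in\mathbb N,$$ in particular, $z^{(1)}=z$; $$Z_-z^{(0)}=0\quad\text{and}\quad Z_-z^{(n)}=z^{(n-1)},\quad n\in\mathbb N;$$ $$\limsup_{n\to\infty}\sqrt[n]{|z^{(n)}|}\le1 \quad\text{for every } z\in\mathbf V(\Lambda).$$ Moreover, $z^{(0)},z^{(1)},z^{(2)},\dots$ form a linearly independent vector family in $\mathcal H(\Lambda)$.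
   Context: Rhombic lattice: $\Lambda$ is a monohedral (edge-to-edge) tessellation of $\mathbb C$ by mutually congruent (nondegenerate) rhombi of side length 1, viewed as a planar graph with vertex set $\mathbf V(\Lambda)$, (undirected) edge set $\mathbf E(\Lambda)$ and face set $\mathbf F(\Lambda)$ (the rhombi). $\hat{\mathbf E}(\Lambda)=\{b-a:(a,b)\in\mathbf E(\Lambda)\}$ is the set of edge directions; it is finite and closed under $e\mapsto -e$. A path from $a$ to $b$ is a finite sequence $(z_0=a,z_1,\dots,z_N=b)$ of vertices with consecutive ones adjacent; it is closed if $a=b$. Standing assumptions: $0\in\mathbf V(\Lambda)$; $1\in\hat{\mathbf E}(\Lambda)$; and both sides of every track $F$ in $\Lambda$ contain tracks that are coherent to $F$. Here a track is a sequence $(F_n)_{n\in\mathbb Z}$ of faces such that for every $n$ the faces $F_n,F_{n+1}$ are adjacent and the edges shared by $F_n$ with $F_{n+1}$ and with $F_{n-1}$ are two opposite sides of $F_n$; these shared edges are the ties of the track. The sides of a track are the two connected components of the graph obtained by deleting all ties of the track from $\mathbf E(\Lambda)$. Two tracks are coherent if their ties are parallel. DA functions: for $f:\mathbf V(\Lambda)\to\mathbb C$ and a path $\gamma=(z_0,\dots,z_N)$, $\int_\gamma f\,\delta z=\sum_{n=1}^N\frac{f(z_{n-1})+f(z_n)}{2}(z_n-z_{n-1})$. $f$ is discrete analytic (DA) if $\int_\gamma f\,\delta z=0$ for every closed path $\gamma$; $\int_a^b f\,\delta z$ denotes the then path-independent integral along any path from $a$ to $b$. $\mathcal H(\Lambda)$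 is the space of (complex-valued) DA functions. Shifts: $(Z_+f)(z)=\frac{f(0)-f(z)}{2}+\int_0^z f\,\delta z$ maps $\mathcal H(\Lambda)$ to itself, and is injective with range $\{f\in\mathcal H(\Lambda):f(0)=0\}$. $Z_-g$ is the unique element of $\mathcal H(\Lambda)$ with $(Z_+Z_-g)(z)=g(z)-g(0)$. The product defining $e_t(z)$ is independent of the path, and for fixed $z$ it is a rational function of $t$, analytic in $\mathbb D$; for $t\in\mathbb D$ the function $e_t$ is DA and spans the one-dimensional eigenspace of $Z_-$ for the eigenvalue $t$. $\mathbb N=\{1,2,3,\dots\}$. *)

(* Defs.v *)
From Stdlib Require Export Reals ZArith List Relations ClassicalEpsilon.
From Coquelicot Require Export Coquelicot.
Export ListNotations.

Open Scope R_scope.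
Open Scope C_scope.

Definition parallel (u v : C) : Prop := exists k : R, u = k * v \/ v = k * u.

Record rhombus : Type := Rhombus {
  base : C;
  dir1 : C;
  dir2 : C;
  dir1_unit : Cmod dir1 = 1%R;
  dir2_unit : Cmod dir2 = 1%R;
  nondegenerate : ~ parallel dir1 dir2
}.

Definition corners (r : rhombus) : list C :=
  [base r; base r + dir1 r; base r + dir1 r + dir2 r; base r + dir2 r].

Definition corner (r : rhombus) (p : C) : Prop := In p (corners r).

(** Sides are unordered: [side r a b] and [side r b a] are equivalent. *)
Definition side (r : rhombus) (a b : C) : Prop :=
  exists p q : C,
    In (p, q) (combine (corners r) (tl (corners r) ++ [base r])) /\
    ((a = p /\ b = q) \/ (a = q /\ b = p)).

(** Two sides of a rhombus are opposite when they have no common endpoint. *)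
Definition opposite_sides (r : rhombus) (a b c d : C) : Prop :=
  side r a b /\ side r c d /\ a <> c /\ a <> d /\ b <> c /\ b <> d.

Definition segment (a b z : C) : Prop :=
  exists s : R, (0 <= s <= 1)%R /\ z = a + s * (b - a).

Definition region (r : rhombus) (z : C) : Prop :=
  exists s t : R, (0 <= s <= 1)%R /\ (0 <= t <= 1)%R /\
    z = base r + s * dir1 r + t * dir2 r.

Definition plane_isometry (phi : C -> C) : Prop :=
  forall x y : C, Cmod (phi x - phi y) = Cmod (x - y).

Definition congruent (r r' : rhombus) : Prop :=
  exists phi : C -> C, plane_isometry phi /\
    forall z : C, region r' z <-> exists w : C, region r w /\ z = phi w.

Definition meet_edge_to_edge (r r' : rhombus) : Prop :=
  (forall z : C, ~ (region r z /\ region r' z)) \/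
  (exists p : C, corner r p /\ corner r' p /\
     forall z : C, region r z /\ region r' z <-> z = p) \/
  (exists a b : C, side r a b /\ side r' a b /\
     forall z : C, region r z /\ region r' z <-> segment a b z).

(** The faces are an abstract index type; edge-to-edge meeting forces distinct
    indices to carry distinct tiles with disjoint interiors. *)
Record rhombic_lattice : Type := RhombicLattice {
  face : Type;
  shape :> face -> rhombus;
  faces_congruent : forall i j : face, congruent (shape i) (shape j);
  faces_cover : forall z : C, exists i : face, region (shape i) z;
  faces_edge_to_edge :
    forall i j : face, i <> j -> meet_edge_to_edge (shape i) (shape j)
}.

Definition is_vertex (L : rhombic_lattice) (z : C) : Prop :=
  exists i : face L, corner (L i) z.

Definition edge (L : rhombic_lattice) (a b : C) : Prop :=
  exists i : face L, side (L i) a b.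

Definition edge_direction (L : rhombic_lattice) (e : C) : Prop :=
  exists a b : C, edge L a b /\ e = b - a.

Record vertex (L : rhombic_lattice) : Type := Vertex {
  point :> C;
  point_is_vertex : is_vertex L point
}.

Definition shared_edge (L : rhombic_lattice) (i j : face L) (a b : C) : Prop :=
  i <> j /\ side (L i) a b /\ side (L j) a b.

Definition is_track (L : rhombic_lattice) (F : Z -> face L) : Prop :=
  forall n : Z, exists a b c d : C,
    shared_edge L (F n) (F (n + 1)%Z) a b /\
    shared_edge L (F n) (F (n - 1)%Z) c d /\
    opposite_sides (L (F n)) a b c d.

Definition tie (L : rhombic_lattice) (F : Z -> face L) (a b : C) : Prop :=
  exists n : Z, shared_edge L (F n) (F (n + 1)%Z) a b.

Definition coherent (L : rhombic_lattice) (F G : Z -> face L) : Prop :=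
  forall a b c d : C, tie L F a b -> tie L G c d -> parallel (b - a) (d - c).

Definition untied_edge (L : rhombic_lattice) (F : Z -> face L) (a b : C)
  : Prop := edge L a b /\ ~ tie L F a b.

(** The sides of the track [F] are the connected components of the graph
    without the ties of [F]; [track_side L F a] is the one containing [a]. *)
Definition track_side (L : rhombic_lattice) (F : Z -> face L) (a : C)
  : C -> Prop := clos_refl_trans C (untied_edge L F) a.

Definition track_side_contains (L : rhombic_lattice) (F : Z -> face L) (a : C)
    (G : Z -> face L) : Prop :=
  forall (n : Z) (x y : C), side (L (G n)) x y ->
    track_side L F a x /\ track_side L F a y /\ untied_edge L F x y.

Definition coherent_tracks_on_both_sides (L : rhombic_lattice) : Prop :=
  forall F : Z -> face L, is_track L F ->
  forall a : vertex L, exists G : Z -> face L,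
    is_track L G /\ coherent L F G /\ track_side_contains L F a G.

(** The path [(a = z_0, z_1, ..., z_N = b)] is given by [a] and the list
    [[z_1; ...; z_N]]. *)
Fixpoint is_path (L : rhombic_lattice) (a : vertex L) (l : list (vertex L))
    (b : vertex L) : Prop :=
  match l with
  | [] => a = b
  | z :: l' => edge L a z /\ is_path L z l' b
  end.

(** The common value of a path functional on all paths from [a] to [b];
    unspecified if the functional depends on the path. *)
Definition along_any_path (L : rhombic_lattice)
    (J : vertex L -> list (vertex L) -> C) (a b : vertex L) : C :=
  epsilon (inhabits (RtoC 0))
    (fun w : C => forall l : list (vertex L), is_path L a l b -> J a l = w).

Fixpoint path_integral (L : rhombic_lattice) (f : vertex L -> C)
    (a : vertex L) (l : list (vertex L)) : C :=
  match l with
  | [] => 0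
  | z :: l' => (f a + f z) / 2 * (z - a) + path_integral L f z l'
  end.

Definition discrete_analytic (L : rhombic_lattice) (f : vertex L -> C)
  : Prop :=
  forall (a : vertex L) (l : list (vertex L)),
    is_path L a l a -> path_integral L f a l = 0.

Definition integral (L : rhombic_lattice) (f : vertex L -> C)
    (a b : vertex L) : C :=
  along_any_path L (path_integral L f) a b.

(** In the sequel [o] is the vertex at the origin of the plane. *)

Definition Zplus (L : rhombic_lattice) (o : vertex L) (f : vertex L -> C)
    (z : vertex L) : C :=
  (f o - f z) / 2 + integral L f o z.

(** The unique discrete analytic [h] such that [Zplus h = g - g o];
    unspecified if there is no such [h]. *)
Definition Zminus (L : rhombic_lattice) (o : vertex L) (g : vertex L -> C)
  : vertex L -> C :=
  epsilon (inhabits (fun _ : vertex L => RtoC 0))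
    (fun h : vertex L -> C => discrete_analytic L h /\
       forall z : vertex L, Zplus L o h z = g z - g o).

Fixpoint exp_product (L : rhombic_lattice) (t : C)
    (a : vertex L) (l : list (vertex L)) : C :=
  match l with
  | [] => 1
  | z :: l' =>
      (2 + t * (1 + z - a)) / (2 + t * (1 + a - z)) * exp_product L t z l'
  end.

Definition discrete_exp (L : rhombic_lattice) (o : vertex L) (t : C)
    (z : vertex L) : C :=
  along_any_path L (exp_product L t) o z.

(** [zpow n z] is the coefficient of [t ^ n] in the expansion of
    [discrete_exp L o t z] on the open unit disk. *)
Definition taylor_coefficients (L : rhombic_lattice) (o : vertex L)
    (zpow : nat -> vertex L -> C) : Prop :=
  forall (t : C) (z : vertex L), (Cmod t < 1)%R ->
    is_pseries (K := C_AbsRing) (V := C_NormedModule)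
      (fun n : nat => zpow n z) t (discrete_exp L o t z).

(** The [n]-th root of [x >= 0]; [Rpower 0 (/ INR n)] is not [0], which is why
    the case [x = 0] is separated. *)
Definition nth_root (n : nat) (x : R) : R :=
  if Req_EM_T x 0 then 0%R else Rpower x (/ INR n).

Definition linearly_independent (X : Type) (f : nat -> X -> C) : Prop :=
  forall (N : nat) (a : nat -> C),
    (forall x : X, sum_n (fun n : nat => a n * f n x) N = RtoC 0) ->
    forall n : nat, (n <= N)%nat -> a n = 0.

(* Main.v *)
(** The plane is simply connected.  On each rhombus an additive edge function with zero sum around
    the rhombus has a potential.  By local finiteness these potentials form a locally constant
    system on the plane, which has a primitive on every square: cut the square into cells that are
    smaller than a Lebesgue number and glue.  Hence a function on the vertices is discrete analytic
    as soon as its integral around each rhombus vanishes.  Applied to [Zplus f], this gives discrete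
    powers defined by [Zplus]-recursion.  Along an edge of direction [e] the recursion reads
    [(2 + t (1 - e)) E_b = (2 + t (1 + e)) E_a] for the generating functions [E], so these are the
    products defining [e_t].  The factors [(1 + e) / 2] and [(1 - e) / 2] have modulus at most 1,
    hence absolute convergence in the unit disk is inherited along edges.

    [Zplus] is injective.  If [Zplus h = 0] then [h b (1 - e) = h a (1 + e)] along edges, so [h]
    vanishes at the left end of each edge of direction 1, and vanishing propagates along the edges
    of any other direction.  Deleting the edges of direction 1 must therefore not leave a component
    without left ends.  Such a component has a track of direction 1 on its left, and walking to
    a coherent track on the right of that one reveals a second track with the component on its
    right.
    All rhombi have the same height, so each of the two tracks meets every horizontal line; by the
    intermediate value theorem their midlines meet, and then the tracks coincide. *)
Require Import Defs.
From Stdlib Require Import Lra Lia ProofIrrelevance FunctionalExtensionality.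

(** * Coordinates in a rhombus *)

Definition cross (u v : C) : R := (fst u * snd v - snd u * fst v)%R.

Definition inner (u v : C) : R := (fst u * fst v + snd u * snd v)%R.

Lemma C_eq (u v : C) : fst u = fst v -> snd u = snd v -> u = v.
Proof. destruct u, v; simpl; intros -> ->; reflexivity. Qed.

Lemma unit_sqr (u : C) : Cmod u = 1%R -> (fst u * fst u + snd u * snd u = 1)%R.
Proof.
  intros H. unfold Cmod in H.
  assert (E : (sqrt (fst u ^ 2 + snd u ^ 2) * sqrt (fst u ^ 2 + snd u ^ 2) = 1)%R)
    by (rewrite H; ring).
  rewrite sqrt_sqrt in E by nra. lra.
Qed.

(** Unit vectors [u], [v] with zero determinant satisfy [u = inner u v * v], so they would be
    parallel. *)
Lemma cross_dirs_neq_0 (r : rhombus) : cross (dir1 r) (dir2 r) <> 0%R.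
Proof.
  intros H. apply (nondegenerate r).
  pose proof (unit_sqr _ (dir1_unit r)) as H1.
  pose proof (unit_sqr _ (dir2_unit r)) as H2.
  unfold cross in H. set (u := dir1 r) in *. set (v := dir2 r) in *.
  exists (inner u v). left. unfold inner.
  apply C_eq; simpl.
  - transitivity (fst u * (fst v * fst v + snd v * snd v))%R; [rewrite H2; ring|].
    replace (fst u * (fst v * fst v + snd v * snd v))%R with
      ((fst u * fst v + snd u * snd v) * fst v + snd v * (fst u * snd v - snd u * fst v))%R
      by ring.
    rewrite H. ring.
  - transitivity (snd u * (fst v * fst v + snd v * snd v))%R; [rewrite H2; ring|].
    replace (snd u * (fst v * fst v + snd v * snd v))%R with
      ((fst u * fst v + snd u * snd v) * snd v - fst v * (fst u * snd v - snd u * fst v))%R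
      by ring.
    rewrite H. ring.
Qed.

Lemma cross_inner_sqr (r : rhombus) :
  (cross (dir1 r) (dir2 r) * cross (dir1 r) (dir2 r) +
   inner (dir1 r) (dir2 r) * inner (dir1 r) (dir2 r) = 1)%R.
Proof.
  pose proof (unit_sqr _ (dir1_unit r)) as H1.
  pose proof (unit_sqr _ (dir2_unit r)) as H2.
  unfold cross, inner. set (u := dir1 r) in *. set (v := dir2 r) in *.
  transitivity ((fst u * fst u + snd u * snd u) * (fst v * fst v + snd v * snd v))%R;
    [ring | rewrite H1, H2; ring].
Qed.

(** Cramer's rule: [cx] and [cy] are the affine coordinates that turn the rhombus into the unit
    square. *)
Definition cx (r : rhombus) (z : C) : R :=
  (cross (z - base r) (dir2 r) / cross (dir1 r) (dir2 r))%R.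

Definition cy (r : rhombus) (z : C) : R :=
  (cross (dir1 r) (z - base r) / cross (dir1 r) (dir2 r))%R.

Definition at_coords (r : rhombus) (s t : R) : C :=
  base r + s * dir1 r + t * dir2 r.

Lemma cx_at_coords (r : rhombus) (s t : R) : cx r (at_coords r s t) = s.
Proof.
  pose proof (cross_dirs_neq_0 r) as H. unfold cx, at_coords.
  apply (Rmult_eq_reg_r (cross (dir1 r) (dir2 r))); [|exact H].
  unfold Rdiv. rewrite Rmult_assoc, Rinv_l, Rmult_1_r by exact H.
  unfold cross; simpl; ring.
Qed.

Lemma cy_at_coords (r : rhombus) (s t : R) : cy r (at_coords r s t) = t.
Proof.
  pose proof (cross_dirs_neq_0 r) as H. unfold cy, at_coords.
  apply (Rmult_eq_reg_r (cross (dir1 r) (dir2 r))); [|exact H].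
  unfold Rdiv. rewrite Rmult_assoc, Rinv_l, Rmult_1_r by exact H.
  unfold cross; simpl; ring.
Qed.

Lemma at_coords_cx_cy (r : rhombus) (z : C) : at_coords r (cx r z) (cy r z) = z.
Proof.
  pose proof (cross_dirs_neq_0 r) as H. unfold cx, cy, at_coords.
  unfold cross in *. apply C_eq; simpl; field; exact H.
Qed.

Lemma coords_inj (r : rhombus) (z w : C) : cx r z = cx r w -> cy r z = cy r w -> z = w.
Proof.
  intros Hx Hy. rewrite <- (at_coords_cx_cy r z), <- (at_coords_cx_cy r w), Hx, Hy.
  reflexivity.
Qed.

Lemma region_coords (r : rhombus) (z : C) :
  region r z <-> (0 <= cx r z <= 1)%R /\ (0 <= cy r z <= 1)%R.
Proof.
  split.
  - intros (s & t & Hs & Ht & ->). fold (at_coords r s t).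
    rewrite cx_at_coords, cy_at_coords. auto.
  - intros [Hs Ht]. exists (cx r z), (cy r z).
    split; [exact Hs | split; [exact Ht | symmetry; apply at_coords_cx_cy]].
Qed.

Lemma corners_coords (r : rhombus) :
  corners r = [at_coords r 0 0; at_coords r 1 0; at_coords r 1 1; at_coords r 0 1].
Proof.
  unfold corners, at_coords.
  repeat (apply f_equal2; [apply C_eq; simpl; ring |]). reflexivity.
Qed.

Lemma corner_coords (r : rhombus) (p : C) :
  corner r p <-> (cx r p = 0 \/ cx r p = 1)%R /\ (cy r p = 0 \/ cy r p = 1)%R.
Proof.
  unfold corner. rewrite corners_coords. simpl. split.
  - intros [<-|[<-|[<-|[<-|[]]]]]; rewrite cx_at_coords, cy_at_coords; auto.
  - rewrite <- (at_coords_cx_cy r p) at 5 6 7 8.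
    intros [[-> | ->] [-> | ->]]; auto.
Qed.

Lemma side_coords (r : rhombus) (a b : C) :
  side r a b <-> corner r a /\ corner r b /\
    ((cx r a = cx r b /\ cy r a <> cy r b) \/ (cx r a <> cx r b /\ cy r a = cy r b)).
Proof.
  split.
  - intros (p & q & Hin & Hab). rewrite corners_coords in Hin. simpl in Hin.
    assert (Eb : base r = at_coords r 0 0)
      by (unfold at_coords; apply C_eq; simpl; ring).
    rewrite Eb in Hin.
    rewrite !corner_coords.
    destruct Hin as [E|[E|[E|[E|[]]]]]; injection E; intros Eq Ep; subst p q;
      destruct Hab as [[-> ->]|[-> ->]]; rewrite !cx_at_coords, !cy_at_coords;
      repeat split; auto; lra.
  - rewrite !corner_coords.
    intros ([Ha1 Ha2] & [Hb1 Hb2] & H).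
    rewrite <- (at_coords_cx_cy r a), <- (at_coords_cx_cy r b).
    unfold side. rewrite corners_coords.
    assert (Eb : base r = at_coords r 0 0)
      by (unfold at_coords; apply C_eq; simpl; ring).
    rewrite Eb. simpl.
    destruct Ha1 as [E1|E1], Ha2 as [E2|E2], Hb1 as [E3|E3], Hb2 as [E4|E4];
      rewrite E1, E2, E3, E4 in *; try (exfalso; lra).
    (* Eight of the sixteen cases survive: each of the four sides in both orientations. *)
    all: try (exists (at_coords r 0 0), (at_coords r 1 0); split;
        [tauto | solve [left; split; reflexivity | right; split; reflexivity]]).
    all: try (exists (at_coords r 1 0), (at_coords r 1 1); split;
        [tauto | solve [left; split; reflexivity | right; split; reflexivity]]).
    all: try (exists (at_coords r 1 1), (at_coords r 0 1); split;
        [tauto | solve [left; split; reflexivity | right; split; reflexivity]]).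
    all: try (exists (at_coords r 0 1), (at_coords r 0 0); split;
        [tauto | solve [left; split; reflexivity | right; split; reflexivity]]).
Qed.

Lemma cx_affine (r : rhombus) (a b : C) (s : R) :
  cx r (a + s * (b - a)) = (cx r a + s * (cx r b - cx r a))%R.
Proof.
  pose proof (cross_dirs_neq_0 r) as H. unfold cx, cross in *; simpl.
  field. exact H.
Qed.

Lemma cy_affine (r : rhombus) (a b : C) (s : R) :
  cy r (a + s * (b - a)) = (cy r a + s * (cy r b - cy r a))%R.
Proof.
  pose proof (cross_dirs_neq_0 r) as H. unfold cy, cross in *; simpl.
  field. exact H.
Qed.

Lemma region_segment (r : rhombus) (a b : C) (s : R) :
  region r a -> region r b -> (0 <= s <= 1)%R -> region r (a + s * (b - a)).
Proof.
  rewrite !region_coords, cx_affine, cy_affine. intros. nra.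
Qed.

Lemma corner_region (r : rhombus) (p : C) : corner r p -> region r p.
Proof. rewrite corner_coords, region_coords. lra. Qed.

Lemma side_sym (r : rhombus) (a b : C) : side r a b -> side r b a.
Proof. rewrite !side_coords. intuition. Qed.

Lemma side_corners (r : rhombus) (a b : C) : side r a b -> corner r a /\ corner r b.
Proof. rewrite side_coords. tauto. Qed.

Lemma side_segment_region (r : rhombus) (a b p : C) :
  side r a b -> segment a b p -> region r p.
Proof.
  intros H (s & Hs & ->). apply side_corners in H.
  apply region_segment; auto; apply corner_region; tauto.
Qed.

(** Along a side one coordinate runs affinely between 0 and 1. At a corner it is 0 or 1, so the
    parameter is an endpoint. *)
Lemma corner_in_side (r : rhombus) (a b p : C) :
  side r a b -> corner r p -> segment a b p -> p = a \/ p = b.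
Proof.
  rewrite side_coords, !corner_coords.
  intros (Ha & Hb & Hab) Hp (s & Hs & E).
  assert (E1 := cx_affine r a b s). assert (E2 := cy_affine r a b s).
  rewrite <- E in E1, E2.
  assert (s = 0 \/ s = 1)%R as [-> | ->].
  { destruct Hab as [[Hab Hn]|[Hn Hab]].
    - destruct Ha as [_ [Ha|Ha]], Hb as [_ [Hb|Hb]], Hp as [_ [Hp|Hp]];
        rewrite Ha, Hb, Hp in *; lra.
    - destruct Ha as [[Ha|Ha] _], Hb as [[Hb|Hb] _], Hp as [[Hp|Hp] _];
        rewrite Ha, Hb, Hp in *; lra. }
  - left. rewrite E. apply C_eq; simpl; ring.
  - right. rewrite E. apply C_eq; simpl; ring.
Qed.

(** Sides of the same family through [p] have the same constant coordinate and hence coincide. For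
    sides of different families both coordinates of [p] are 0 or 1, which makes [p] a corner. *)
Lemma sides_through_point (r : rhombus) (a b c d p : C) :
  side r a b -> side r c d -> segment a b p -> segment c d p -> ~ corner r p ->
  (a = c /\ b = d) \/ (a = d /\ b = c).
Proof.
  rewrite !side_coords, !corner_coords.
  intros (Ha & Hb & Hab) (Hc & Hd & Hcd) (s & Hs & E) (t & Ht & E') Hp.
  assert (E1 := cx_affine r a b s). assert (E2 := cy_affine r a b s).
  assert (E3 := cx_affine r c d t). assert (E4 := cy_affine r c d t).
  rewrite <- E in E1, E2. rewrite <- E' in E3, E4.
  assert (K : (cx r a = cx r c /\ cx r b = cx r d /\ cy r a = cy r c /\ cy r b = cy r d)
    \/ (cx r a = cx r d /\ cx r b = cx r c /\ cy r a = cy r d /\ cy r b = cy r c)).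
  { clear E E'. revert Ha Hb Hc Hd Hab Hcd E1 E2 E3 E4 Hp.
    generalize (cx r a) (cy r a) (cx r b) (cy r b) (cx r c) (cy r c) (cx r d) (cy r d)
      (cx r p) (cy r p).
    intros xa ya xb yb xc yc xd yd xp yp Ha Hb Hc Hd Hab Hcd E1 E2 E3 E4 Hp.
    destruct Hab as [[<- Hab]|[Hab <-]], Hcd as [[<- Hcd]|[Hcd <-]].
    - assert (xa = xc) as -> by (clear - E1 E3; lra). clear Hp E1 E3.
      destruct Ha as [_ [-> | ->]], Hb as [_ [-> | ->]], Hc as [_ [-> | ->]],
        Hd as [_ [-> | ->]]; first
        [left; repeat split; reflexivity | right; repeat split; reflexivity | exfalso; lra].
    - exfalso. apply Hp. replace xp with xa by (clear - E1; lra).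
      replace yp with yc by (clear - E4; lra).
      exact (conj (proj1 Ha) (proj2 Hc)).
    - exfalso. apply Hp. replace xp with xc by (clear - E3; lra).
      replace yp with ya by (clear - E2; lra).
      exact (conj (proj1 Hc) (proj2 Ha)).
    - assert (ya = yc) as -> by (clear - E2 E4; lra). clear Hp E2 E4.
      destruct Ha as [[-> | ->] _], Hb as [[-> | ->] _], Hc as [[-> | ->] _],
        Hd as [[-> | ->] _]; first
        [left; repeat split; reflexivity | right; repeat split; reflexivity | exfalso; lra]. }
  destruct K as [(K1 & K2 & K3 & K4)|(K1 & K2 & K3 & K4)]; [left|right];
    split; apply (coords_inj r); assumption.
Qed.

(** * How faces of the tessellation meet *)

Lemma common_point (L : rhombic_lattice) (i j : face L) (p : C) :
  i <> j -> region (L i) p -> region (L j) p ->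
  (corner (L i) p /\ corner (L j) p) \/
  (exists a b : C, side (L i) a b /\ side (L j) a b /\ segment a b p).
Proof.
  intros Hij Hi Hj.
  destruct (faces_edge_to_edge L i j Hij) as [H|[(q & Hq1 & Hq2 & H)|(a & b & Ha & Hb & H)]].
  - destruct (H p); auto.
  - left. destruct (H p) as [H1 _]. rewrite (H1 (conj Hi Hj)). auto.
  - right. exists a, b. repeat split; auto. apply H. auto.
Qed.

Lemma side_boundary (r : rhombus) (a b p : C) :
  side r a b -> segment a b p -> ~ ((0 < cx r p < 1)%R /\ (0 < cy r p < 1)%R).
Proof.
  rewrite side_coords, !corner_coords. intros (Ha & Hb & Hab) (s & Hs & ->).
  rewrite cx_affine, cy_affine.
  destruct Hab as [[Hab _]|[_ Hab]]; rewrite Hab in *; intros [H1 H2]; nra.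
Qed.

Lemma interior_one_face (L : rhombic_lattice) (i j : face L) (p : C) :
  region (L i) p -> (0 < cx (L j) p < 1)%R -> (0 < cy (L j) p < 1)%R -> i = j.
Proof.
  intros Hi Hx Hy.
  destruct (excluded_middle_informative (i = j)) as [|Hij]; [assumption|exfalso].
  assert (Hj : region (L j) p) by (rewrite region_coords; lra).
  destruct (common_point L i j p Hij Hi Hj) as [[_ H]|(a & b & _ & Hs & H)].
  - rewrite corner_coords in H. lra.
  - apply (side_boundary _ _ _ _ Hs H). auto.
Qed.

(** Two distinct common corners rule out an empty or one-point intersection, and a corner on the
    common side is one of its endpoints. *)
Lemma common_corners_side (L : rhombic_lattice) (i j : face L) (p q : C) :
  i <> j -> p <> q -> corner (L i) p -> corner (L j) p -> corner (L i) q ->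
  corner (L j) q -> side (L i) p q /\ side (L j) p q.
Proof.
  intros Hij Hpq Hip Hjp Hiq Hjq.
  destruct (faces_edge_to_edge L i j Hij) as [H|[(v & Hv1 & Hv2 & H)|(a & b & Ha & Hb & H)]].
  - destruct (H p). split; apply corner_region; assumption.
  - exfalso. apply Hpq. transitivity v.
    + apply H. split; apply corner_region; assumption.
    + symmetry. apply H. split; apply corner_region; assumption.
  - assert (Sp : segment a b p) by (apply H; split; apply corner_region; assumption).
    assert (Sq : segment a b q) by (apply H; split; apply corner_region; assumption).
    destruct (corner_in_side _ _ _ _ Ha Hip Sp) as [-> | ->],
      (corner_in_side _ _ _ _ Ha Hiq Sq) as [-> | ->]; try congruence.
    + auto.
    + split; apply side_sym; assumption.
Qed.

(** Edge-to-edge meeting excludes T-junctions: a vertex on a common side is a corner of one of the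
    faces, hence an endpoint of that side. *)
Lemma vertex_in_face (L : rhombic_lattice) (j : face L) (p : C) :
  is_vertex L p -> region (L j) p -> corner (L j) p.
Proof.
  intros (i & Hi) Hj.
  destruct (excluded_middle_informative (i = j)) as [<- |Hij]; [assumption|].
  destruct (common_point L i j p Hij (corner_region _ _ Hi) Hj)
    as [[_ H]|(a & b & Ha & Hb & H)]; [assumption|].
  destruct (corner_in_side _ _ _ _ Ha Hi H) as [-> | ->]; apply (side_corners _ _ _ Hb).
Qed.

Lemma edge_in_face (L : rhombic_lattice) (j : face L) (a b p : C) :
  edge L a b -> segment a b p -> ~ is_vertex L p -> region (L j) p -> side (L j) a b.
Proof.
  intros (i & Hi) Hp Hv Hj.
  destruct (excluded_middle_informative (i = j)) as [<- |Hij]; [assumption|].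
  destruct (common_point L i j p Hij (side_segment_region _ _ _ _ Hi Hp) Hj)
    as [[H _]|(c & d & Hc & Hd & H)].
  - destruct Hv. exists i. exact H.
  - assert (N : ~ corner (L i) p) by (intros N; apply Hv; exists i; exact N).
    destruct (sides_through_point _ _ _ _ _ _ Hi Hc Hp H N) as [[-> ->]|[-> ->]].
    + exact Hd.
    + apply side_sym, Hd.
Qed.

(** A vertex shared by all faces through [p] lets data on vertices be read at arbitrary points of
    the plane. It is [p] itself, an end of an edge through [p], or a corner of the only face that
    contains [p]. *)
Lemma star_vertex (L : rhombic_lattice) (p : C) :
  exists v : C, (is_vertex L p -> v = p) /\
    forall j : face L, region (L j) p -> corner (L j) v.
Proof.
  destruct (excluded_middle_informative (is_vertex L p)) as [Hv|Hv].
  { exists p. split; [auto|]. intros j. apply vertex_in_face, Hv. }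
  destruct (excluded_middle_informative (exists a b, edge L a b /\ segment a b p))
    as [(a & b & He & Hs)|He].
  { exists a. split; [tauto|]. intros j Hj.
    apply (side_corners _ a b), (edge_in_face L j a b p); assumption. }
  destruct (faces_cover L p) as (i & Hi).
  exists (base (L i)). split; [tauto|]. intros j Hj.
  destruct (excluded_middle_informative (i = j)) as [<- |Hij].
  { unfold corner, corners. left. reflexivity. }
  exfalso. destruct (common_point L i j p Hij Hi Hj) as [[H _]|(a & b & Ha & _ & H)].
  - apply Hv. exists i. exact H.
  - apply He. exists a, b. split; [exists i; exact Ha|exact H].
Qed.

(** * The common height of the faces *)

Lemma sqr_norm_diff (r : rhombus) (z w : C) :
  let s := (cx r z - cx r w)%R in
  let t := (cy r z - cy r w)%R in
  (Cmod (z - w) ^ 2 = s * s + t * t + 2 * (s * t * inner (dir1 r) (dir2 r)))%R.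
Proof.
  intros s t.
  pose proof (unit_sqr _ (dir1_unit r)) as H1.
  pose proof (unit_sqr _ (dir2_unit r)) as H2.
  assert (Ez : z - w = s * dir1 r + t * dir2 r).
  { rewrite <- (at_coords_cx_cy r z), <- (at_coords_cx_cy r w) at 1.
    unfold at_coords, s, t. apply C_eq; simpl; ring. }
  rewrite Ez. unfold Cmod. rewrite pow2_sqrt by nra. unfold inner. simpl.
  transitivity (s * s * (fst (dir1 r) * fst (dir1 r) + snd (dir1 r) * snd (dir1 r)) +
    t * t * (fst (dir2 r) * fst (dir2 r) + snd (dir2 r) * snd (dir2 r)) +
    2 * (s * t * (fst (dir1 r) * fst (dir2 r) + snd (dir1 r) * snd (dir2 r))))%R;
    [ring|rewrite H1, H2; ring].
Qed.

(** The squared diameter of a unit rhombus is [2 + 2 * Rabs (inner dir1 dir2)]. *)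
Lemma congruent_inner_le (r r' : rhombus) :
  congruent r r' -> (Rabs (inner (dir1 r') (dir2 r')) <= Rabs (inner (dir1 r) (dir2 r)))%R.
Proof.
  intros (phi & Hphi & H).
  assert (U : forall z w, region r' z -> region r' w ->
    (Cmod (z - w) ^ 2 <= 2 + 2 * Rabs (inner (dir1 r) (dir2 r)))%R).
  { intros z w Hz Hw. apply H in Hz, Hw.
    destruct Hz as (z' & Hz & ->), Hw as (w' & Hw & ->).
    rewrite Hphi, (sqr_norm_diff r). apply region_coords in Hz, Hw.
    set (k := inner (dir1 r) (dir2 r)).
    assert (Hs : (-1 <= cx r z' - cx r w' <= 1)%R) by lra.
    assert (Ht : (-1 <= cy r z' - cy r w' <= 1)%R) by lra.
    revert Hs Ht.
    generalize (cx r z' - cx r w')%R (cy r z' - cy r w')%R. intros s t Hs Ht.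
    assert (s * s <= 1)%R by nra. assert (t * t <= 1)%R by nra.
    assert (-1 <= s * t <= 1)%R by nra.
    unfold Rabs; destruct (Rcase_abs k); nra. }
  (* The two diagonals of [r'] have squared lengths 2 plus and minus twice its [inner]. *)
  assert (A1 := U (at_coords r' 0 0) (at_coords r' 1 1)).
  assert (A2 := U (at_coords r' 1 0) (at_coords r' 0 1)).
  rewrite (sqr_norm_diff r') in A1, A2.
  rewrite !region_coords, !cx_at_coords, !cy_at_coords in A1, A2.
  unfold Rabs at 1. destruct (Rcase_abs (inner (dir1 r') (dir2 r'))); lra.
Qed.

(** As the sides have length 1, the area of the rhombus equals the distance between opposite
    sides. *)
Definition height (r : rhombus) : R := Rabs (cross (dir1 r) (dir2 r)).

Lemma height_pos (r : rhombus) : (0 < height r)%R.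
Proof. apply Rabs_pos_lt, cross_dirs_neq_0. Qed.

(** Congruence fixes the diameter, hence the absolute cosine of the angle, hence by
    [cross_inner_sqr] the absolute sine. *)
Lemma congruent_height (r r' : rhombus) :
  congruent r r' -> congruent r' r -> height r = height r'.
Proof.
  intros H H'. apply congruent_inner_le in H, H'.
  pose proof (cross_inner_sqr r). pose proof (cross_inner_sqr r').
  unfold height.
  assert (E : Rabs (inner (dir1 r) (dir2 r)) = Rabs (inner (dir1 r') (dir2 r'))) by lra.
  apply Rsqr_eq_abs_0. apply Rsqr_eq_asb_1 in E. unfold Rsqr in *. lra.
Qed.

(** * Local finiteness *)

Definition near (e : R) (p q : C) : Prop :=
  (Rabs (fst q - fst p) < e)%R /\ (Rabs (snd q - snd p) < e)%R.

Lemma near_trans (d e : R) (p q z : C) : near d p q -> near e q z -> near (d + e) p z.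
Proof.
  unfold near. intros [H1 H2] [H3 H4].
  apply Rabs_def2 in H1, H2, H3, H4. split; apply Rabs_def1; lra.
Qed.

Lemma near_le (d e : R) (p q : C) : (d <= e)%R -> near d p q -> near e p q.
Proof. unfold near. intros; lra. Qed.

Lemma unit_components (u : C) :
  Cmod u = 1%R -> (-1 <= fst u <= 1)%R /\ (-1 <= snd u <= 1)%R.
Proof. intros H. apply unit_sqr in H. nra. Qed.

Lemma cross_bound (u v : C) (d : R) :
  Cmod v = 1%R -> near d 0 u -> (Rabs (cross u v) < 2 * d)%R.
Proof.
  intros Hv [H1 H2]. apply unit_components in Hv. simpl in H1, H2.
  rewrite Rminus_0_r in H1, H2. unfold cross.
  eapply Rle_lt_trans; [apply Rabs_triang|]. rewrite Rabs_Ropp, !Rabs_mult.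
  assert (Rabs (fst v) <= 1)%R by (apply Rabs_le; lra).
  assert (Rabs (snd v) <= 1)%R by (apply Rabs_le; lra).
  pose proof (Rabs_pos (fst u)). pose proof (Rabs_pos (snd u)). nra.
Qed.

Lemma near_diff (d : R) (p q : C) : near d p q -> near d 0 (q - p).
Proof. unfold near; simpl. rewrite !Rminus_0_r. auto. Qed.

Lemma cx_near (r : rhombus) (d : R) (p q : C) :
  near d p q -> (Rabs (cx r q - cx r p) * height r < 2 * d)%R.
Proof.
  intros H. unfold height. rewrite <- Rabs_mult.
  replace ((cx r q - cx r p) * cross (dir1 r) (dir2 r))%R with (cross (q - p) (dir2 r)).
  - apply cross_bound; [apply dir2_unit|apply near_diff, H].
  - pose proof (cross_dirs_neq_0 r). unfold cx, cross in *. simpl. field. assumption.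
Qed.

Lemma cy_near (r : rhombus) (d : R) (p q : C) :
  near d p q -> (Rabs (cy r q - cy r p) * height r < 2 * d)%R.
Proof.
  intros H. unfold height. rewrite <- Rabs_mult.
  replace ((cy r q - cy r p) * cross (dir1 r) (dir2 r))%R
    with (- cross (q - p) (dir1 r))%R.
  - rewrite Rabs_Ropp. apply cross_bound; [apply dir1_unit|apply near_diff, H].
  - pose proof (cross_dirs_neq_0 r). unfold cy, cross in *. simpl. field. assumption.
Qed.

Lemma region_closed (r : rhombus) (p : C) :
  exists e, (0 < e)%R /\ forall q, near e p q -> region r q -> region r p.
Proof.
  destruct (excluded_middle_informative (region r p)) as [Hp|Hp].
  { exists 1%R. split; [lra|auto]. }
  pose proof (height_pos r) as Hh.
  assert (K : exists g, (0 < g)%R /\ (cx r p <= - g \/ cx r p >= 1 + g \/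
     cy r p <= - g \/ cy r p >= 1 + g)%R).
  { rewrite region_coords in Hp.
    destruct (Rlt_dec (cx r p) 0); [exists (- cx r p)%R; split; lra|].
    destruct (Rlt_dec 1 (cx r p)); [exists (cx r p - 1)%R; split; lra|].
    destruct (Rlt_dec (cy r p) 0); [exists (- cy r p)%R; split; lra|].
    destruct (Rlt_dec 1 (cy r p)); [exists (cy r p - 1)%R; split; lra|].
    exfalso. apply Hp. lra. }
  destruct K as (g & Hg & K).
  (* By [cx_near] and [cy_near] a displacement below this radius changes both coordinates by less
     than the gap [g]. *)
  exists (g * height r / 2)%R. split; [nra|].
  intros q Hq. rewrite region_coords. intros [H1 H2]. exfalso.
  apply (cx_near r) in Hq as Hx. apply (cy_near r) in Hq as Hy.
  assert (Rabs (cx r q - cx r p) < g)%R as Gx by nra.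
  assert (Rabs (cy r q - cy r p) < g)%R as Gy by nra.
  apply Rabs_def2 in Gx, Gy. lra.
Qed.

Lemma height_const (L : rhombic_lattice) (i j : face L) : height (L i) = height (L j).
Proof. apply congruent_height; apply faces_congruent. Qed.

Definition center (r : rhombus) : C := at_coords r (1 / 2) (1 / 2).

Lemma center_region (r : rhombus) : region r (center r).
Proof. unfold center. rewrite region_coords, cx_at_coords, cy_at_coords. lra. Qed.

(** A displacement below a quarter of the height changes each coordinate by less than 1/2, so the
    second center would be interior to the first face. *)
Lemma centers_separated (L : rhombic_lattice) (i j : face L) :
  near (height (L i) / 4) (center (L i)) (center (L j)) -> i = j.
Proof.
  intros H. pose proof (height_pos (L i)) as Hh.
  symmetry. apply interior_one_face with (p := center (L j)); [apply center_region| |].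
  - apply (cx_near (L i)) in H. unfold center at 2 in H. rewrite cx_at_coords in H.
    assert (K : (Rabs (cx (L i) (center (L j)) - 1 / 2) < 1 / 2)%R) by nra.
    apply Rabs_def2 in K. lra.
  - apply (cy_near (L i)) in H. unfold center at 2 in H. rewrite cy_at_coords in H.
    assert (K : (Rabs (cy (L i) (center (L j)) - 1 / 2) < 1 / 2)%R) by nra.
    apply Rabs_def2 in K. lra.
Qed.

Lemma region_near_center (r : rhombus) (q : C) : region r q -> near 2 q (center r).
Proof.
  rewrite region_coords. intros [Hx Hy].
  rewrite <- (at_coords_cx_cy r q). unfold center, at_coords.
  pose proof (unit_components _ (dir1_unit r)).
  pose proof (unit_components _ (dir2_unit r)).
  split; simpl; apply Rabs_def1; nra.
Qed.

Lemma grid_index (d x : R) :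
  (0 < d)%R -> (0 <= x)%R -> exists n : nat, (INR n * d <= x < (INR n + 1) * d)%R.
Proof.
  intros Hd Hx. destruct (nfloor_ex (x / d)) as (n & Hn).
  { apply Rle_mult_inv_pos; assumption. }
  exists n. replace x with (x / d * d)%R by (field; lra).
  split; [apply Rmult_le_compat_r|apply Rmult_lt_compat_r]; lra.
Qed.

(** Grid cells whose side is a quarter of the height contain at most one center each, so finitely
    many cells index the faces near [p]. A cell without a center gets an arbitrary face. *)
Lemma locally_finite (L : rhombic_lattice) (p : C) :
  exists (N : nat) (E : nat -> nat -> face L),
    forall i q, near 1 p q -> region (L i) q ->
    exists k l : nat, (k < N)%nat /\ (l < N)%nat /\ E k l = i.
Proof.
  destruct (faces_cover L p) as (i0 & _).
  set (d := (height (L i0) / 4)%R).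
  assert (Hd : (0 < d)%R) by (pose proof (height_pos (L i0)); unfold d; lra).
  (* The centers in question are within 1 + 2 of [p] in each coordinate. Adding 4 makes the offsets
     positive and less than 8, which bounds the cell indices. *)
  set (in_cell := fun (k l : nat) (i : face L) =>
    (INR k * d <= fst (center (L i)) - fst p + 4 < (INR k + 1) * d)%R /\
    (INR l * d <= snd (center (L i)) - snd p + 4 < (INR l + 1) * d)%R).
  destruct (grid_index d 8 Hd ltac:(lra)) as (N & HN).
  exists (S N), (fun k l => epsilon (inhabits i0) (in_cell k l)).
  intros i q Hq Hi. apply region_near_center in Hi.
  pose proof (near_trans _ _ _ _ _ Hq Hi) as [H1 H2].
  apply Rabs_def2 in H1, H2.
  destruct (grid_index d (fst (center (L i)) - fst p + 4) Hd ltac:(lra)) as (k & Hk).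
  destruct (grid_index d (snd (center (L i)) - snd p + 4) Hd ltac:(lra)) as (l & Hl).
  exists k, l.
  assert (B : forall m : nat, (INR m * d < 8)%R -> (m < S N)%nat).
  { intros m Hm. apply INR_lt. rewrite S_INR. nra. }
  split; [apply B; lra|]. split; [apply B; lra|].
  assert (Ec : in_cell k l i) by (split; assumption).
  pose proof (epsilon_spec (inhabits i0) (in_cell k l) (ex_intro _ i Ec)) as Es.
  set (j := epsilon (inhabits i0) (in_cell k l)) in *. clearbody j.
  apply centers_separated. rewrite (height_const L j i0). fold d.
  destruct Es, Ec. split; apply Rabs_def1; lra.
Qed.

(** The minimum of finitely many radii works. [A] and [Q] are abstract because the lemma serves both
    the entries of one row of cells and the rows themselves. *)
Lemma finite_radius (A : Type) (E : nat -> A) (Q : A -> R -> Prop) :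
  (forall a d e, (d <= e)%R -> Q a e -> Q a d) ->
  (forall a, exists e, (0 < e)%R /\ Q a e) ->
  forall N : nat, exists e, (0 < e)%R /\ forall k : nat, (k < N)%nat -> Q (E k) e.
Proof.
  intros Hmon HQ N. induction N as [|N (e & He & IH)].
  - exists 1%R. split; [lra|lia].
  - destruct (HQ (E N)) as (d & Hd & Hn). exists (Rmin d e).
    split; [apply Rmin_glb_lt; assumption|]. intros k Hk.
    destruct (Nat.eq_dec k N) as [-> |].
    + apply (Hmon _ _ d); [apply Rmin_l|exact Hn].
    + apply (Hmon _ _ e); [apply Rmin_r|apply IH; lia].
Qed.

(** Only finitely many faces come close to [p], and those that miss [p] keep a positive distance
    from it, being closed. *)
Lemma local_star (L : rhombic_lattice) (p : C) :
  exists e, (0 < e)%R /\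
    forall i q, near e p q -> region (L i) q -> region (L i) p.
Proof.
  destruct (locally_finite L p) as (N & E & HE).
  set (Q := fun i e => forall q, near e p q -> region (L i) q -> region (L i) p).
  assert (Hmon : forall i d e, (d <= e)%R -> Q i e -> Q i d).
  { intros i d e Hde HQ q Hq. apply HQ, (near_le d); assumption. }
  destruct (finite_radius (nat -> face L) E
    (fun f e => forall l, (l < N)%nat -> Q (f l) e)) with (N := N) as (e & He & H).
  - intros f d e Hde HQ l Hl. apply (Hmon _ d e Hde), HQ, Hl.
  - intros f. apply (finite_radius (face L) f Q Hmon). intros i. apply region_closed.
  - exists (Rmin 1 e). split; [apply Rmin_glb_lt; lra|]. intros i q Hq Hi.
    destruct (HE i q) as (k & l & Hk & Hl & <-);
      [apply (near_le _ 1 _ _ (Rmin_l _ _) Hq)|exact Hi|].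
    apply (H k Hk l Hl q); [apply (near_le _ e _ _ (Rmin_r _ _) Hq)|exact Hi].
Qed.

(** * Primitives of locally constant systems *)

(** Connectedness of the unit interval: the supremum of the [t] up to which [g] keeps its initial
    value belongs to the set and cannot be less than 1. *)
Lemma locally_constant_interval (X : Type) (g : R -> X) :
  (forall t, (0 <= t <= 1)%R -> exists e, (0 < e)%R /\
     forall t', (0 <= t' <= 1)%R -> (Rabs (t' - t) < e)%R -> g t' = g t) ->
  g 0%R = g 1%R.
Proof.
  intros H.
  set (S := fun t => (0 <= t <= 1)%R /\ forall t', (0 <= t' <= t)%R -> g t' = g 0%R).
  assert (S0 : S 0%R).
  { split; [lra|]. intros t' Ht'. f_equal. lra. }
  destruct (completeness S) as (m & Hub & Hlub).
  { exists 1%R. intros t [Ht _]. lra. }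
  { exists 0%R. exact S0. }
  assert (Hm : (0 <= m <= 1)%R).
  { split; [apply Hub, S0|]. apply Hlub. intros t [Ht _]. lra. }
  destruct (H m Hm) as (e & He & Hg).
  destruct (excluded_middle_informative (exists t, S t /\ (m - e < t)%R))
    as [(t & [Ht HSt] & Hmt)|N].
  2:{ exfalso. assert (m <= m - e)%R; [|lra]. apply Hlub. intros t Ht.
      apply Rnot_lt_le. intros Hlt. apply N. exists t. auto. }
  assert (Htm : (t <= m)%R) by (apply Hub; split; assumption).
  assert (Egm : g m = g 0%R).
  { transitivity (g t); [symmetry; apply Hg; [lra|apply Rabs_def1; lra]|apply HSt; lra]. }
  assert (Sm : S (Rmin 1 (m + e / 2))).
  { pose proof (Rmin_l 1 (m + e / 2)). pose proof (Rmin_r 1 (m + e / 2)).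
    split; [split; [apply Rmin_glb; lra|assumption]|].
    intros t' Ht'. destruct (Rle_dec t' t) as [Hle|Hle].
    - apply HSt. lra.
    - rewrite <- Egm. apply Hg; [lra|apply Rabs_def1; lra]. }
  destruct (Rle_dec 1 (m + e / 2)) as [Hle|Hle].
  - rewrite Rmin_left in Sm by assumption. symmetry. apply Sm. lra.
  - rewrite Rmin_right in Sm by lra. apply Hub in Sm. lra.
Qed.

Lemma locally_constant_segment (X : Type) (g : C -> X) (a b : C) :
  (forall p, segment a b p -> exists e, (0 < e)%R /\
     forall q, segment a b q -> near e p q -> g q = g p) ->
  g a = g b.
Proof.
  intros H.
  assert (E : g (a + 0%R * (b - a)) = g (a + 1%R * (b - a))).
  { apply (locally_constant_interval X (fun t : R => g (a + t * (b - a)))). intros t Ht.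
    destruct (H (a + t * (b - a))) as (e & He & Hg); [exists t; auto|].
    (* A Lipschitz constant of the parametrization; the summand 1 keeps it positive when [a = b]. *)
    set (k := (Rabs (fst b - fst a) + Rabs (snd b - snd a) + 1)%R).
    pose proof (Rabs_pos (fst b - fst a)%R) as P1. pose proof (Rabs_pos (snd b - snd a)%R) as P2.
    assert (Hk : (0 < k)%R) by (unfold k; lra).
    exists (e / k)%R. split; [apply Rdiv_lt_0_compat; assumption|].
    intros t' Ht' Hd. apply Hg; [exists t'; auto|].
    assert (Hd' : (Rabs (t' - t) * k < e)%R).
    { apply (Rmult_lt_compat_r k) in Hd; [|assumption].
      unfold Rdiv in Hd. rewrite Rmult_assoc, Rinv_l, Rmult_1_r in Hd; lra. }
    pose proof (Rabs_pos (t' - t)).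
    split.
    - replace (fst (a + t' * (b - a))%C - fst (a + t * (b - a))%C)%R
        with ((t' - t) * (fst b - fst a))%R by (simpl; ring).
      rewrite Rabs_mult. unfold k in Hd'. nra.
    - replace (snd (a + t' * (b - a))%C - snd (a + t * (b - a))%C)%R
        with ((t' - t) * (snd b - snd a))%R by (simpl; ring).
      rewrite Rabs_mult. unfold k in Hd'. nra. }
  replace (a + 0%R * (b - a)) with a in E by (apply C_eq; simpl; ring).
  replace (a + 1%R * (b - a)) with b in E by (apply C_eq; simpl; ring).
  exact E.
Qed.

(** [psi p q] prescribes the increment from [p] to [q] for [q] close to [p]. *)
Definition primitive_on (psi : C -> C -> C) (D : C -> Prop) (s : C -> C) : Prop :=
  forall p, D p -> exists e, (0 < e)%R /\
    forall q, D q -> near e p q -> s q - s p = psi p q.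

Definition convex (D : C -> Prop) : Prop :=
  forall a b p, D a -> D b -> segment a b p -> D p.

Definition closed_set (D : C -> Prop) : Prop :=
  forall p, ~ D p -> exists e, (0 < e)%R /\ forall q, near e p q -> ~ D q.

Lemma primitive_on_subset (psi : C -> C -> C) (D D' : C -> Prop) (s : C -> C) :
  (forall p, D' p -> D p) -> primitive_on psi D s -> primitive_on psi D' s.
Proof.
  intros HD H p Hp. destruct (H p (HD p Hp)) as (e & He & Hs).
  exists e. split; [exact He|]. intros q Hq. apply Hs, HD, Hq.
Qed.

(** The difference of two primitives is locally constant along the segment from [p] to [q], which
    stays in [D] by convexity. *)
Lemma primitive_unique (psi : C -> C -> C) (D : C -> Prop) (s s' : C -> C) (p q : C) :
  convex D -> primitive_on psi D s -> primitive_on psi D s' -> D p -> D q ->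
  s p - s' p = s q - s' q.
Proof.
  intros HD Hs Hs' Hp Hq.
  apply (locally_constant_segment C (fun z => s z - s' z)).
  intros z Hz. assert (Dz : D z) by (apply (HD p q); assumption).
  destruct (Hs z Dz) as (e & He & H), (Hs' z Dz) as (e' & He' & H').
  exists (Rmin e e'). split; [apply Rmin_glb_lt; assumption|].
  intros w Hw Hn. assert (Dw : D w) by (apply (HD p q); assumption).
  specialize (H w Dw (near_le _ _ _ _ (Rmin_l _ _) Hn)).
  specialize (H' w Dw (near_le _ _ _ _ (Rmin_r _ _) Hn)).
  rewrite <- H' in H.
  replace (s w - s' w) with ((s w - s z) - (s' w - s' z) + (s z - s' z)) by ring.
  rewrite H. ring.
Qed.

(** On the convex intersection the two primitives differ by a constant, so one of them can be
    shifted. By closedness a point outside one set has a neighbourhood that avoids it, where only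
    the other primitive matters. *)
Lemma primitive_glue (psi : C -> C -> C) (D D' : C -> Prop) (s s' : C -> C) :
  closed_set D -> closed_set D' -> convex D -> convex D' ->
  primitive_on psi D s -> primitive_on psi D' s' ->
  exists u, primitive_on psi (fun p => D p \/ D' p) u.
Proof.
  intros Cl Cl' Co Co' Hs Hs'.
  assert (K : exists c, forall p, D p -> D' p -> s p = s' p + c).
  { destruct (excluded_middle_informative (exists p, D p /\ D' p)) as [(p & Hp & Hp')|N].
    - exists (s p - s' p). intros q Hq Hq'.
      rewrite (primitive_unique psi (fun z => D z /\ D' z) s s' p q); auto.
      + ring.
      + intros a b z [Ha Ha'] [Hb Hb'] Hz. split; [apply (Co a b)|apply (Co' a b)]; assumption.
      + apply (primitive_on_subset _ D); tauto.
      + apply (primitive_on_subset _ D'); tauto.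
    - exists 0. intros p Hp Hp'. destruct N. exists p. auto. }
  destruct K as (c & Hc).
  exists (fun p => if excluded_middle_informative (D p) then s p else s' p + c).
  assert (V : forall p, D' p ->
    (if excluded_middle_informative (D p) then s p else s' p + c) = s' p + c).
  { intros p Hp. destruct (excluded_middle_informative (D p)); auto. }
  assert (V' : forall p, D p ->
    (if excluded_middle_informative (D p) then s p else s' p + c) = s p).
  { intros p Hp. destruct (excluded_middle_informative (D p)); tauto. }
  intros p Hp.
  assert (W : exists e, (0 < e)%R /\ forall q, D q -> near e p q -> D p /\ s q - s p = psi p q).
  { destruct (excluded_middle_informative (D p)) as [Dp|Dp].
    - destruct (Hs p Dp) as (e & He & H). exists e. auto.
    - destruct (Cl p Dp) as (e & He & H). exists e. split; [exact He|].
      intros q Dq Hq. destruct (H q Hq Dq). }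
  assert (W' : exists e, (0 < e)%R /\ forall q, D' q -> near e p q ->
    D' p /\ s' q - s' p = psi p q).
  { destruct (excluded_middle_informative (D' p)) as [Dp|Dp].
    - destruct (Hs' p Dp) as (e & He & H). exists e. auto.
    - destruct (Cl' p Dp) as (e & He & H). exists e. split; [exact He|].
      intros q Dq Hq. destruct (H q Hq Dq). }
  destruct W as (e & He & W), W' as (e' & He' & W').
  exists (Rmin e e'). split; [apply Rmin_glb_lt; assumption|].
  intros q [Dq|Dq] Hn.
  - destruct (W q Dq (near_le _ _ _ _ (Rmin_l _ _) Hn)) as [Dp E].
    rewrite (V' p Dp), (V' q Dq). exact E.
  - destruct (W' q Dq (near_le _ _ _ _ (Rmin_r _ _) Hn)) as [Dp E].
    rewrite (V p Dp), (V q Dq), <- E. ring.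
Qed.

Definition rectangle (a b c d : R) (p : C) : Prop :=
  (a <= fst p <= b)%R /\ (c <= snd p <= d)%R.

Lemma rectangle_convex (a b c d : R) : convex (rectangle a b c d).
Proof.
  intros p q z [Hp1 Hp2] [Hq1 Hq2] (s & Hs & ->).
  split; simpl; nra.
Qed.

Lemma rectangle_closed (a b c d : R) : closed_set (rectangle a b c d).
Proof.
  intros p Hp.
  assert (K : exists g, (0 < g)%R /\ (fst p <= a - g \/ fst p >= b + g \/
     snd p <= c - g \/ snd p >= d + g)%R).
  { unfold rectangle in Hp.
    destruct (Rlt_dec (fst p) a); [exists (a - fst p)%R; split; lra|].
    destruct (Rlt_dec b (fst p)); [exists (fst p - b)%R; split; lra|].
    destruct (Rlt_dec (snd p) c); [exists (c - snd p)%R; split; lra|].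
    destruct (Rlt_dec d (snd p)); [exists (snd p - d)%R; split; lra|].
    exfalso. apply Hp. lra. }
  destruct K as (g & Hg & K). exists g. split; [exact Hg|].
  intros q [H1 H2] [H3 H4]. apply Rabs_def2 in H1, H2. lra.
Qed.

Lemma primitive_extend (psi : C -> C -> C) (a b c d a' b' c' d' : R) (D : C -> Prop) :
  (exists s, primitive_on psi (rectangle a b c d) s) ->
  (exists s, primitive_on psi (rectangle a' b' c' d') s) ->
  (forall p, D p -> rectangle a b c d p \/ rectangle a' b' c' d' p) ->
  exists s, primitive_on psi D s.
Proof.
  intros (s & Hs) (s' & Hs') HD.
  destruct (primitive_glue psi _ _ s s' (rectangle_closed a b c d) (rectangle_closed a' b' c' d')
    (rectangle_convex _ _ _ _) (rectangle_convex _ _ _ _) Hs Hs') as (u & Hu).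
  exists u. apply (primitive_on_subset _ _ _ _ HD Hu).
Qed.

Lemma primitive_on_square (psi : C -> C -> C) (r : R) :
  (0 < r)%R ->
  (forall p, exists e, (0 < e)%R /\ exists s, primitive_on psi (near e p) s) ->
  exists s, primitive_on psi (rectangle (- r) r (- r) r) s.
Proof.
  intros Hr Hloc.
  (* With half of a local radius, a ball of radius at most [e] around a point within [e] of [(u, v)]
     still carries a primitive. Compactness then provides a Lebesgue number [d]. *)
  assert (Hdelta : forall u v : R, { e : posreal |
    exists s, primitive_on psi (near (2 * e) (u, v)) s }).
  { intros u v. apply constructive_indefinite_description.
    destruct (Hloc (u, v)) as (e & He & Hs).
    assert (He' : (0 < e / 2)%R) by lra.
    exists (mkposreal (e / 2) He'). simpl.
    replace (2 * (e / 2))%R with e by field. exact Hs. }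
  destruct (compactness_value_2d (- r) r (- r) r (fun u v => proj1_sig (Hdelta u v)))
    as (d & Hd).
  assert (Hsmall : forall x y, (- r <= x <= r)%R -> (- r <= y <= r)%R ->
    exists s, primitive_on psi (near d (x, y)) s).
  { intros x y Hx Hy. specialize (Hd x y Hx Hy).
    destruct (excluded_middle_informative
      (exists s, primitive_on psi (near d (x, y)) s)) as [|N]; [assumption|].
    exfalso. apply Hd. intros (u & v & _ & _ & H1 & H2 & H3). apply N.
    destruct (Hdelta u v) as (e & s & Hs). simpl in *.
    exists s. apply (primitive_on_subset _ (near (2 * e) (u, v))); [|exact Hs].
    intros q Hq. apply (near_le (e + d)); [lra|].
    apply (near_trans _ _ _ (x, y)); [split; assumption|exact Hq]. }
  pose proof (cond_pos d) as Hdpos.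
  destruct (nfloor_ex (2 * r / (d / 2))) as (n & Hn).
  { apply Rlt_le, Rdiv_lt_0_compat; lra. }
  set (h := (2 * r / (INR n + 1))%R).
  assert (Hn0 : (0 <= INR n)%R) by apply pos_INR.
  assert (Hh : (0 < h)%R) by (apply Rdiv_lt_0_compat; lra).
  assert (Hhn : ((INR n + 1) * h = 2 * r)%R) by (unfold h; field; lra).
  assert (Hhd : (h < d)%R).
  { destruct Hn as [_ Hn]. apply (Rmult_lt_compat_r (d / 2)) in Hn; [|lra].
    replace (2 * r / (d / 2) * (d / 2))%R with (2 * r)%R in Hn by (field; lra).
    nra. }
  assert (Hcell : forall x y, (- r <= x <= r)%R -> (- r <= y <= r)%R ->
    exists s, primitive_on psi (rectangle x (x + h) y (y + h)) s).
  { intros x y Hx Hy. destruct (Hsmall x y Hx Hy) as (s & Hs). exists s.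
    apply (primitive_on_subset _ (near d (x, y))); [|exact Hs].
    intros q [H1 H2]. split; simpl; apply Rabs_def1; lra. }
  (* Cells of width [h], which is less than [d], are glued to rows from left to right, and rows to
     the square from bottom to top. *)
  assert (Hrow : forall y, (- r <= y <= r)%R -> forall k : nat, (k <= n)%nat ->
    exists s, primitive_on psi (rectangle (- r) (- r + (INR k + 1) * h) y (y + h)) s).
  { intros y Hy k. induction k as [|k IH]; intros Hk.
    - simpl. replace ((0 + 1) * h)%R with h by ring. apply Hcell; lra.
    - assert (Hk' : (INR (S k) <= INR n)%R) by (apply le_INR; exact Hk).
      rewrite S_INR in *. pose proof (pos_INR k).
      refine (primitive_extend psi _ _ _ _ _ _ _ _ _ (IH ltac:(lia))
        (Hcell (- r + (INR k + 1) * h)%R y _ Hy) _).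
      + nra.
      + unfold rectangle. intros p Hp.
        destruct (Rle_dec (fst p) (- r + (INR k + 1) * h)); [left|right]; lra. }
  assert (Hcol : forall k : nat, (k <= n)%nat ->
    exists s, primitive_on psi (rectangle (- r) r (- r) (- r + (INR k + 1) * h)) s).
  { assert (Hrow' : forall y, (- r <= y <= r)%R ->
      exists s, primitive_on psi (rectangle (- r) r y (y + h)) s).
    { intros y Hy. destruct (Hrow y Hy n (le_n n)) as (s & Hs). exists s.
      replace (- r + (INR n + 1) * h)%R with r in Hs by lra. exact Hs. }
    intros k. induction k as [|k IH]; intros Hk.
    - simpl. replace ((0 + 1) * h)%R with h by ring. apply Hrow'; lra.
    - assert (Hk' : (INR (S k) <= INR n)%R) by (apply le_INR; exact Hk).
      rewrite S_INR in *. pose proof (pos_INR k).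
      refine (primitive_extend psi _ _ _ _ _ _ _ _ _ (IH ltac:(lia))
        (Hrow' (- r + (INR k + 1) * h)%R _) _).
      + nra.
      + unfold rectangle. intros p Hp.
        destruct (Rle_dec (snd p) (- r + (INR k + 1) * h)); [left|right]; lra. }
  destruct (Hcol n (le_n n)) as (s & Hs). exists s.
  replace (- r + (INR n + 1) * h)%R with r in Hs by lra. exact Hs.
Qed.

(** * Potentials on the lattice *)

Lemma edge_sym (L : rhombic_lattice) (a b : C) : edge L a b -> edge L b a.
Proof. intros (i & Hi). exists i. apply side_sym, Hi. Qed.

Lemma edge_vertices (L : rhombic_lattice) (a b : C) :
  edge L a b -> is_vertex L a /\ is_vertex L b.
Proof. intros (i & Hi). apply side_corners in Hi. split; exists i; tauto. Qed.

Lemma corners_connected (L : rhombic_lattice) (i : face L) (p q : C) :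
  corner (L i) p -> corner (L i) q -> clos_refl_trans C (edge L) p q.
Proof.
  intros Hp Hq.
  assert (K : forall z, corner (L i) z -> cx (L i) p = cx (L i) z \/ cy (L i) p = cy (L i) z ->
     clos_refl_trans C (edge L) p z).
  { intros z Hz Hc.
    destruct (excluded_middle_informative (p = z)) as [<- |N]; [apply rt_refl|].
    apply rt_step. exists i. apply side_coords. split; [exact Hp|]. split; [exact Hz|].
    destruct (Req_dec (cx (L i) p) (cx (L i) z)) as [E|E],
      (Req_dec (cy (L i) p) (cy (L i) z)) as [E'|E']; try tauto.
    destruct N. apply (coords_inj (L i)); assumption. }
  set (m := at_coords (L i) (cx (L i) p) (cy (L i) q)).
  assert (Hm : corner (L i) m).
  { unfold m. apply corner_coords in Hp, Hq. apply corner_coords.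
    rewrite cx_at_coords, cy_at_coords. tauto. }
  apply rt_trans with m.
  - apply K; [exact Hm|]. left. unfold m. rewrite cx_at_coords. reflexivity.
  - destruct (excluded_middle_informative (m = q)) as [Emq|N]; [rewrite Emq; apply rt_refl|].
    apply rt_step. exists i. apply side_coords. split; [exact Hm|]. split; [exact Hq|].
    right. unfold m. rewrite cy_at_coords. split; [|reflexivity].
    intros E. apply N. apply (coords_inj (L i)); [exact E|].
    unfold m. rewrite cy_at_coords. reflexivity.
Qed.

Definition star (L : rhombic_lattice) (p : C) : C :=
  proj1_sig (constructive_indefinite_description _ (star_vertex L p)).

Lemma star_of_vertex (L : rhombic_lattice) (p : C) : is_vertex L p -> star L p = p.
Proof.
  unfold star. destruct (constructive_indefinite_description _ _) as (v & H1 & H2). exact H1.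
Qed.

Lemma star_corner (L : rhombic_lattice) (p : C) (i : face L) :
  region (L i) p -> corner (L i) (star L p).
Proof.
  unfold star. destruct (constructive_indefinite_description _ _) as (v & H1 & H2). apply H2.
Qed.

(** Whether [star L p] is reachable from [a] depends on [p] in a locally constant way, since all
    faces that come close to [p] contain [p] and the corners of a face are connected. *)
Lemma vertices_connected (L : rhombic_lattice) (a b : C) :
  is_vertex L a -> is_vertex L b -> clos_refl_trans C (edge L) a b.
Proof.
  intros Ha Hb.
  assert (Hsym : forall p q, clos_refl_trans C (edge L) p q -> clos_refl_trans C (edge L) q p).
  { intros p q H. induction H as [p q H| |p q z _ IH1 _ IH2].
    - apply rt_step, edge_sym, H.
    - apply rt_refl.
    - apply rt_trans with q; assumption. }
  set (g := fun p => if excluded_middle_informative (clos_refl_trans C (edge L) a (star L p))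
    then true else false).
  assert (E : g a = g b).
  { apply locally_constant_segment. intros p _.
    destruct (local_star L p) as (e & He & H). exists e. split; [exact He|].
    intros q _ Hq. destruct (faces_cover L q) as (i & Hi).
    assert (Hp := H i q Hq Hi).
    assert (K := corners_connected L i _ _ (star_corner L p i Hp) (star_corner L q i Hi)).
    unfold g.
    destruct (excluded_middle_informative (clos_refl_trans C (edge L) a (star L q))) as [Y|Y],
      (excluded_middle_informative (clos_refl_trans C (edge L) a (star L p))) as [Y'|Y'];
      try reflexivity; exfalso.
    - apply Y'. apply rt_trans with (star L q); auto.
    - apply Y. apply rt_trans with (star L p); auto. }
  unfold g in E. rewrite (star_of_vertex L a Ha), (star_of_vertex L b Hb) in E.
  destruct (excluded_middle_informative (clos_refl_trans C (edge L) a b)) as [|N];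
    [assumption|].
  destruct (excluded_middle_informative (clos_refl_trans C (edge L) a a)) as [_|N'];
    [discriminate E|]. destruct N'. apply rt_refl.
Qed.

Lemma vertex_eq (L : rhombic_lattice) (a b : vertex L) : point L a = point L b -> a = b.
Proof.
  destruct a as [a Ha], b as [b Hb]. simpl. intros <-. f_equal. apply proof_irrelevance.
Qed.

Lemma path_exists (L : rhombic_lattice) (a b : vertex L) :
  exists l : list (vertex L), is_path L a l b.
Proof.
  assert (K : forall p q, clos_refl_trans_1n C (edge L) p q -> forall a b : vertex L,
    point L a = p -> point L b = q -> exists l, is_path L a l b).
  { intros p q H. induction H as [p|p q z Hpq _ IH]; intros u v Hu Hv.
    - exists []. simpl. apply vertex_eq. congruence.
    - destruct (edge_vertices L p q Hpq) as [_ Hq].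
      destruct (IH (Vertex L q Hq) v eq_refl Hv) as (l & Hl).
      exists (Vertex L q Hq :: l). simpl. rewrite Hu. split; assumption. }
  apply (K (point L a) (point L b)); try reflexivity.
  apply clos_rt_rt1n, vertices_connected; apply point_is_vertex.
Qed.

Definition corner_vertex (L : rhombic_lattice) (i : face L) (p : C)
  (H : corner (L i) p) : vertex L := Vertex L p (ex_intro _ i H).

(** A total version with value 0 off the vertices, so that points given by formulas can serve as
    arguments. *)
Definition extend (L : rhombic_lattice) (f : vertex L -> C) (p : C) : C :=
  match excluded_middle_informative (is_vertex L p) with
  | left H => f (Vertex L p H)
  | right _ => 0
  end.

Lemma extend_vertex (L : rhombic_lattice) (f : vertex L -> C) (v : vertex L) :
  extend L f v = f v.
Proof.
  unfold extend. destruct (excluded_middle_informative (is_vertex L v)) as [H|H].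
  - f_equal. apply vertex_eq. reflexivity.
  - destruct H. apply point_is_vertex.
Qed.

Definition increment (f : C -> C) (a b : C) : C := (f a + f b) / 2 * (b - a).

Lemma increment_sym (f : C -> C) (a b : C) : increment f b a = - increment f a b.
Proof. unfold increment, Cdiv. ring. Qed.

(** The left side is twice the integral around the rhombus. Its vanishing means equal difference
    quotients along the two diagonals, the discrete Cauchy-Riemann equation. *)
Definition face_closed (f : C -> C) (r : rhombus) : Prop :=
  (f (base r) - f (base r + dir1 r + dir2 r)) * (dir1 r - dir2 r) +
  (f (base r + dir1 r) - f (base r + dir2 r)) * (dir1 r + dir2 r) = 0.

Lemma face_potential (f : C -> C) (r : rhombus) :
  face_closed f r ->
  exists phi : C -> C, forall a b, side r a b -> phi b - phi a = increment f a b.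
Proof.
  intros Hf.
  set (p0 := base r) in *. set (p1 := base r + dir1 r) in *.
  set (p2 := base r + dir1 r + dir2 r) in *. set (p3 := base r + dir2 r) in *.
  set (phi := fun p : C =>
    if excluded_middle_informative (p = p0) then RtoC 0 else
    if excluded_middle_informative (p = p1) then increment f p0 p1 else
    if excluded_middle_informative (p = p2) then increment f p0 p1 + increment f p1 p2
    else increment f p0 p3).
  assert (N : p1 <> p0 /\ p2 <> p0 /\ p3 <> p0 /\ p2 <> p1 /\ p3 <> p1 /\ p3 <> p2).
  { assert (C0 : p0 = at_coords r 0 0) by (unfold p0, at_coords; apply C_eq; simpl; ring).
    assert (C1 : p1 = at_coords r 1 0) by (unfold p1, at_coords; apply C_eq; simpl; ring).
    assert (C2 : p2 = at_coords r 1 1) by (unfold p2, at_coords; apply C_eq; simpl; ring).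
    assert (C3 : p3 = at_coords r 0 1) by (unfold p3, at_coords; apply C_eq; simpl; ring).
    rewrite C0, C1, C2, C3.
    repeat split; intros E;
      assert (E1 := f_equal (cx r) E); assert (E2 := f_equal (cy r) E);
      rewrite !cx_at_coords in E1; rewrite !cy_at_coords in E2; lra. }
  destruct N as (N1 & N2 & N3 & N4 & N5 & N6).
  assert (V0 : phi p0 = 0).
  { unfold phi. destruct (excluded_middle_informative (p0 = p0)); tauto. }
  assert (V1 : phi p1 = increment f p0 p1).
  { unfold phi. destruct (excluded_middle_informative (p1 = p0)); [tauto|].
    destruct (excluded_middle_informative (p1 = p1)); tauto. }
  assert (V2 : phi p2 = increment f p0 p1 + increment f p1 p2).
  { unfold phi. destruct (excluded_middle_informative (p2 = p0)); [tauto|].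
    destruct (excluded_middle_informative (p2 = p1)); [tauto|].
    destruct (excluded_middle_informative (p2 = p2)); tauto. }
  assert (V3 : phi p3 = increment f p0 p3).
  { unfold phi. destruct (excluded_middle_informative (p3 = p0)); [tauto|].
    destruct (excluded_middle_informative (p3 = p1)); [tauto|].
    destruct (excluded_middle_informative (p3 = p2)); tauto. }
  clearbody phi. exists phi.
  assert (K : forall p q, In (p, q) [(p0, p1); (p1, p2); (p2, p3); (p3, p0)] ->
    phi q - phi p = increment f p q).
  { intros p q [E|[E|[E|[E|[]]]]]; injection E; intros <- <-; rewrite ?V0, ?V1, ?V2, ?V3.
    - ring.
    - ring.
    (* The side from [p2] to [p3] closes the circuit; the other three increments hold by
       construction of [phi]. *)
    - assert (E4 : increment f p0 p1 + increment f p1 p2 - increment f p0 p3 +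
        increment f p2 p3 = ((f p0 - f p2) * (dir1 r - dir2 r) +
          (f p1 - f p3) * (dir1 r + dir2 r)) / 2).
      { unfold increment, Cdiv, p0, p1, p2, p3. ring. }
      change ((f p0 - f p2) * (dir1 r - dir2 r) + (f p1 - f p3) * (dir1 r + dir2 r) = 0) in Hf.
      rewrite Hf in E4.
      replace (increment f p0 p3 - (increment f p0 p1 + increment f p1 p2)) with
       (increment f p2 p3 - (increment f p0 p1 + increment f p1 p2 - increment f p0 p3 +
        increment f p2 p3)) by ring.
      rewrite E4. unfold Cdiv. ring.
    - rewrite (increment_sym f p0 p3). ring. }
  intros a b (p & q & Hin & [[-> ->]|[-> ->]]).
  - apply K, Hin.
  - rewrite increment_sym, <- (K p q Hin). ring.
Qed.

(** The face potentials, read at the vertex [star L p] for each point [p] of the plane, form a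
    locally constant system; a global primitive exists because squares are simply connected. *)
Lemma potential_on_square (L : rhombic_lattice) (f : C -> C) (r : R) :
  (0 < r)%R -> (forall i, face_closed f (L i)) ->
  exists s : C -> C, forall a b, edge L a b ->
    rectangle (- r) r (- r) r a -> rectangle (- r) r (- r) r b ->
    s b - s a = increment f a b.
Proof.
  intros Hr Hf.
  assert (Hphi : forall i, { phi : C -> C | forall a b, side (L i) a b ->
    phi b - phi a = increment f a b }).
  { intros i. apply constructive_indefinite_description, face_potential, Hf. }
  set (phi := fun i => proj1_sig (Hphi i)).
  assert (Pphi : forall i a b, side (L i) a b -> phi i b - phi i a = increment f a b)
    by (intros i; exact (proj2_sig (Hphi i))).
  clearbody phi. clear Hphi.
  (* Distinct faces with two distinct common corners share that side, where both potentials have the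
     prescribed increment. Hence [psi] below does not depend on the chosen face. *)
  assert (Hcomp : forall i j p q, corner (L i) p -> corner (L j) p -> corner (L i) q ->
    corner (L j) q -> phi i q - phi i p = phi j q - phi j p).
  { intros i j p q Hip Hjp Hiq Hjq.
    destruct (excluded_middle_informative (i = j)) as [<- |Hij]; [reflexivity|].
    destruct (excluded_middle_informative (p = q)) as [<- |Hpq]; [ring|].
    destruct (common_corners_side L i j p q) as [H1 H2]; try assumption.
    rewrite (Pphi i p q H1), (Pphi j p q H2). reflexivity. }
  destruct (faces_cover L 0) as (i0 & _).
  set (psi := fun p q : C =>
    let i := epsilon (inhabits i0) (fun i => region (L i) p /\ region (L i) q) in
    phi i (star L q) - phi i (star L p)).
  assert (Hpsi : forall i p q, region (L i) p -> region (L i) q ->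
    psi p q = phi i (star L q) - phi i (star L p)).
  { intros i p q Hp Hq. unfold psi.
    pose proof (epsilon_spec (inhabits i0) (fun i => region (L i) p /\ region (L i) q)
      (ex_intro _ i (conj Hp Hq))) as [Hp' Hq'].
    apply Hcomp; apply star_corner; assumption. }
  clearbody psi.
  destruct (primitive_on_square psi r Hr) as (s & Hs).
  (* Near [p] the function [psi p] itself is a primitive: a face that contains a point close enough
     to [q] contains [p] and [q] as well. *)
  { intros p. destruct (local_star L p) as (e & He & H). exists e. split; [exact He|].
    exists (psi p). intros q Hq. destruct (local_star L q) as (d & Hd & H').
    exists d. split; [exact Hd|].
    intros z Hz Hqz. destruct (faces_cover L z) as (i & Hi).
    assert (Hiq := H' i z Hqz Hi). assert (Hip := H i z Hz Hi).
    rewrite (Hpsi i p z), (Hpsi i p q), (Hpsi i q z) by assumption. ring. }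
  exists s. intros a b He Ha Hb. destruct (edge_vertices L a b He) as [Va Vb].
  destruct He as (i & Hi). rewrite <- (Pphi i a b Hi).
  (* All points of the edge lie in the face [i], where [s] and [phi i] read at [star] have the same
     local increments. *)
  assert (E : s a - phi i (star L a) = s b - phi i (star L b)).
  { apply (locally_constant_segment C (fun z => s z - phi i (star L z))).
    intros p Hp. assert (Rp := rectangle_convex _ _ _ _ a b p Ha Hb Hp).
    destruct (Hs p Rp) as (e & He & H). exists e. split; [exact He|].
    intros q Hq Hn. specialize (H q (rectangle_convex _ _ _ _ a b q Ha Hb Hq) Hn).
    rewrite (Hpsi i) in H by (apply (side_segment_region _ a b); assumption).
    replace (s q - phi i (star L q)) with (s q - s p + s p - phi i (star L q)) by ring.
    rewrite H. ring. }
  rewrite (star_of_vertex L a Va), (star_of_vertex L b Vb) in E.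
  replace (s b - s a) with ((s b - phi i b) - s a + phi i b) by ring.
  rewrite <- E. ring.
Qed.

Lemma path_in_square (L : rhombic_lattice) (a : vertex L) (l : list (vertex L)) :
  exists r, (0 < r)%R /\ forall z, In z (a :: l) -> rectangle (- r) r (- r) r (point L z).
Proof.
  revert a. induction l as [|b l IH]; intros a.
  - exists (Rabs (fst (point L a)) + Rabs (snd (point L a)) + 1)%R.
    pose proof (Rabs_pos (fst (point L a))). pose proof (Rabs_pos (snd (point L a))).
    split; [lra|]. intros z [<- |[]].
    split; apply Rabs_le_between; lra.
  - destruct (IH b) as (r & Hr & H).
    exists (r + (Rabs (fst (point L a)) + Rabs (snd (point L a)) + 1))%R.
    pose proof (Rabs_pos (fst (point L a))). pose proof (Rabs_pos (snd (point L a))).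
    split; [lra|]. intros z [<- |Hz].
    + split; apply Rabs_le_between; lra.
    + destruct (H z Hz). split; lra.
Qed.

Lemma face_closed_discrete_analytic (L : rhombic_lattice) (f : vertex L -> C) :
  (forall i, face_closed (extend L f) (L i)) -> discrete_analytic L f.
Proof.
  intros Hf a l Hl.
  destruct (path_in_square L a l) as (r & Hr & Hin).
  destruct (potential_on_square L (extend L f) r Hr Hf) as (s & Hs).
  assert (K : forall l a b, is_path L a l b ->
    (forall z, In z (a :: l) -> rectangle (- r) r (- r) r (point L z)) ->
    path_integral L f a l = s b - s a).
  { clear a l Hl Hin. induction l as [|z l IH]; intros a b Hl Hin.
    - simpl in *. subst b. ring.
    - destruct Hl as [He Hl]. simpl path_integral.
      rewrite (IH z b Hl (fun w Hw => Hin w (or_intror Hw))).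
      assert (E : s z - s a = (f a + f z) / 2 * (z - a)).
      { rewrite (Hs a z He); [|apply Hin; left; reflexivity
                               |apply Hin; right; left; reflexivity].
        unfold increment. rewrite !extend_vertex. reflexivity. }
      rewrite <- E. ring. }
  rewrite (K l a a Hl Hin). ring.
Qed.

Lemma discrete_analytic_face_closed (L : rhombic_lattice) (f : vertex L -> C) (i : face L) :
  discrete_analytic L f -> face_closed (extend L f) (L i).
Proof.
  intros Hf.
  assert (H0 : corner (L i) (base (L i))) by (left; reflexivity).
  assert (H1 : corner (L i) (base (L i) + dir1 (L i))) by (right; left; reflexivity).
  assert (H2 : corner (L i) (base (L i) + dir1 (L i) + dir2 (L i)))
    by (right; right; left; reflexivity).
  assert (H3 : corner (L i) (base (L i) + dir2 (L i))) by (right; right; right; left; reflexivity).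
  set (v0 := corner_vertex L i _ H0). set (v1 := corner_vertex L i _ H1).
  set (v2 := corner_vertex L i _ H2). set (v3 := corner_vertex L i _ H3).
  assert (E : path_integral L f v0 [v1; v2; v3; v0] = 0).
  { apply Hf. simpl.
    repeat split; exists i; eexists; eexists;
      (split; [|left; split; reflexivity]); simpl; tauto. }
  simpl in E. unfold face_closed.
  change (base (L i)) with (point L v0) at 1.
  change (base (L i) + dir1 (L i) + dir2 (L i)) with (point L v2) at 1.
  change (base (L i) + dir1 (L i)) with (point L v1) at 1.
  change (base (L i) + dir2 (L i)) with (point L v3) at 1.
  rewrite !extend_vertex.
  transitivity (2 * ((f v0 + f v1) / 2 * (base (L i) + dir1 (L i) - base (L i)) +
     ((f v1 + f v2) / 2 * (base (L i) + dir1 (L i) + dir2 (L i) - (base (L i) + dir1 (L i))) +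
      ((f v2 + f v3) / 2 * (base (L i) + dir2 (L i) - (base (L i) + dir1 (L i) + dir2 (L i))) +
       ((f v3 + f v0) / 2 * (base (L i) - (base (L i) + dir2 (L i))) + 0))))).
  - field.
  - simpl in E. rewrite E. ring.
Qed.

(** * The shift and the discrete powers *)

Lemma path_app (L : rhombic_lattice) (f : vertex L -> C) (l l' : list (vertex L))
    (a b c : vertex L) :
  is_path L a l b -> is_path L b l' c ->
  is_path L a (l ++ l') c /\
  path_integral L f a (l ++ l') = path_integral L f a l + path_integral L f b l'.
Proof.
  revert a. induction l as [|z l IH]; intros a Hl Hl'; simpl in *.
  - subst b. split; [exact Hl'|ring].
  - destruct Hl as [He Hl]. destruct (IH z Hl Hl') as [H1 H2].
    split; [auto|]. rewrite H2. ring.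
Qed.

Lemma path_reverse (L : rhombic_lattice) (f : vertex L -> C) (l : list (vertex L))
    (a b : vertex L) :
  is_path L a l b ->
  exists l', is_path L b l' a /\ path_integral L f b l' = - path_integral L f a l.
Proof.
  revert a. induction l as [|z l IH]; intros a Hl; simpl in *.
  - subst b. exists []. split; [reflexivity|simpl; ring].
  - destruct Hl as [He Hl]. destruct (IH z Hl) as (l' & H1 & H2).
    assert (Hz : is_path L z [a] a) by (simpl; split; [apply edge_sym, He|reflexivity]).
    destruct (path_app L f l' [a] b z a H1 Hz) as [H3 H4].
    exists (l' ++ [a]). split; [exact H3|].
    rewrite H4, H2. simpl. unfold Cdiv. ring.
Qed.

(** A path from [a] to [b] exists, so the value chosen by [epsilon] can only be [w]. *)
Lemma along_any_path_spec (L : rhombic_lattice) (J : vertex L -> list (vertex L) -> C)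
    (a b : vertex L) (w : C) :
  (forall l, is_path L a l b -> J a l = w) -> along_any_path L J a b = w.
Proof.
  intros H. unfold along_any_path.
  pose proof (epsilon_spec (inhabits (RtoC 0))
    (fun w : C => forall l : list (vertex L), is_path L a l b -> J a l = w)
    (ex_intro _ w H)) as Hs.
  destruct (path_exists L a b) as (l & Hl).
  rewrite <- (H l Hl). symmetry. apply Hs, Hl.
Qed.

Lemma integral_path (L : rhombic_lattice) (f : vertex L -> C) (a b : vertex L)
    (l : list (vertex L)) :
  discrete_analytic L f -> is_path L a l b -> integral L f a b = path_integral L f a l.
Proof.
  intros Hf Hl. apply along_any_path_spec. intros l' Hl'.
  destruct (path_reverse L f l a b Hl) as (k & Hk & Ek).
  destruct (path_app L f l' k a b a Hl' Hk) as [H1 H2].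
  rewrite (Hf a _ H1), Ek in H2.
  replace (path_integral L f a l') with
    (path_integral L f a l' + - path_integral L f a l + path_integral L f a l) by ring.
  rewrite <- H2. ring.
Qed.

Lemma integral_step (L : rhombic_lattice) (f : vertex L -> C) (o a b : vertex L) :
  discrete_analytic L f -> edge L a b ->
  integral L f o b = integral L f o a + (f a + f b) / 2 * (b - a).
Proof.
  intros Hf He. destruct (path_exists L o a) as (l & Hl).
  assert (Hb : is_path L a [b] b) by (simpl; auto).
  destruct (path_app L f l [b] o a b Hl Hb) as [H1 H2].
  rewrite (integral_path L f o b _ Hf H1), (integral_path L f o a _ Hf Hl), H2.
  simpl. ring.
Qed.

Lemma Zplus_step (L : rhombic_lattice) (o : vertex L) (f : vertex L -> C) (a b : vertex L) :
  discrete_analytic L f -> edge L a b ->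
  Zplus L o f b - Zplus L o f a = (f a - f b) / 2 + (f a + f b) / 2 * (b - a).
Proof.
  intros Hf He. unfold Zplus. rewrite (integral_step L f o a b Hf He).
  unfold Cdiv. ring.
Qed.

Lemma Zplus_origin (L : rhombic_lattice) (o : vertex L) (f : vertex L -> C) :
  discrete_analytic L f -> Zplus L o f o = 0.
Proof.
  intros Hf. unfold Zplus. rewrite (integral_path L f o o [] Hf) by reflexivity.
  simpl. unfold Cdiv. ring.
Qed.

(** The value at the origin and the increments along edges determine a function on the connected
    graph. This identifies [Zplus L o f] without evaluating integrals. *)
Lemma Zplus_unique (L : rhombic_lattice) (o : vertex L) (f g : vertex L -> C) :
  discrete_analytic L f -> g o = 0 ->
  (forall a b : vertex L, edge L a b ->
     g b - g a = (f a - f b) / 2 + (f a + f b) / 2 * (b - a)) ->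
  forall z, Zplus L o f z = g z.
Proof.
  intros Hf Ho Hg.
  assert (K : forall l a b, is_path L a l b ->
    Zplus L o f b - g b = Zplus L o f a - g a).
  { induction l as [|z l IH]; intros a b Hl; simpl in Hl.
    - subst b. reflexivity.
    - destruct Hl as [He Hl]. rewrite (IH z b Hl).
      replace (Zplus L o f z) with ((Zplus L o f z - Zplus L o f a) + Zplus L o f a) by ring.
      replace (g z) with ((g z - g a) + g a) by ring.
      rewrite (Zplus_step L o f a z Hf He), (Hg a z He). ring. }
  intros z. destruct (path_exists L o z) as (l & Hl).
  specialize (K l o z Hl). rewrite (Zplus_origin L o f Hf), Ho in K.
  replace (Zplus L o f z) with ((Zplus L o f z - g z) + g z) by ring.
  rewrite K. ring.
Qed.

(** Substituting the increments of [Zplus L o f] along three sides of a face turns the left side of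
    its face condition into [- (1 + d1) / 2] times that of [f]. *)
Lemma Zplus_discrete_analytic (L : rhombic_lattice) (o : vertex L) (f : vertex L -> C) :
  discrete_analytic L f -> discrete_analytic L (Zplus L o f).
Proof.
  intros Hf. apply face_closed_discrete_analytic. intros i.
  pose proof (discrete_analytic_face_closed L f i Hf) as Fi.
  assert (H0 : corner (L i) (base (L i))) by (left; reflexivity).
  assert (H1 : corner (L i) (base (L i) + dir1 (L i))) by (right; left; reflexivity).
  assert (H2 : corner (L i) (base (L i) + dir1 (L i) + dir2 (L i)))
    by (right; right; left; reflexivity).
  assert (H3 : corner (L i) (base (L i) + dir2 (L i))) by (right; right; right; left; reflexivity).
  set (v0 := corner_vertex L i _ H0). set (v1 := corner_vertex L i _ H1).
  set (v2 := corner_vertex L i _ H2). set (v3 := corner_vertex L i _ H3).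
  unfold face_closed in *.
  change (base (L i)) with (point L v0) in Fi at 1 |- * at 1.
  change (base (L i) + dir1 (L i) + dir2 (L i)) with (point L v2) in Fi at 1 |- * at 1.
  change (base (L i) + dir1 (L i)) with (point L v1) in Fi at 1 |- * at 1.
  change (base (L i) + dir2 (L i)) with (point L v3) in Fi at 1 |- * at 1.
  rewrite !extend_vertex in *.
  assert (Hs : forall a b : vertex L, In (point L a, point L b)
      (combine (corners (L i)) (tl (corners (L i)) ++ [base (L i)])) -> edge L a b).
  { intros a b H. exists i, (point L a), (point L b). auto. }
  assert (E1 := Zplus_step L o f v0 v1 Hf (Hs v0 v1 ltac:(simpl; tauto))).
  assert (E2 := Zplus_step L o f v1 v2 Hf (Hs v1 v2 ltac:(simpl; tauto))).
  assert (E3 := Zplus_step L o f v2 v3 Hf (Hs v2 v3 ltac:(simpl; tauto))).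
  change (point L v0) with (base (L i)) in E1.
  change (point L v1) with (base (L i) + dir1 (L i)) in E1, E2.
  change (point L v2) with (base (L i) + dir1 (L i) + dir2 (L i)) in E2, E3.
  change (point L v3) with (base (L i) + dir2 (L i)) in E3.
  transitivity (- (Zplus L o f v1 - Zplus L o f v0 + (Zplus L o f v2 - Zplus L o f v1))
      * (dir1 (L i) - dir2 (L i)) -
     (Zplus L o f v2 - Zplus L o f v1 + (Zplus L o f v3 - Zplus L o f v2))
      * (dir1 (L i) + dir2 (L i))); [ring|].
  rewrite E1, E2, E3. clear E1 E2 E3.
  set (d1 := dir1 (L i)) in *. set (d2 := dir2 (L i)) in *. set (b0 := base (L i)) in *.
  transitivity (((f v0 - f v2) * (d1 - d2) + (f v1 - f v3) * (d1 + d2)) * (- (1 + d1) / 2)).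
  - field.
  - rewrite Fi. ring.
Qed.

Lemma discrete_analytic_const (L : rhombic_lattice) (c : C) :
  discrete_analytic L (fun _ => c).
Proof.
  assert (K : forall l a b, is_path L a l b ->
    path_integral L (fun _ => c) a l = c * (b - a)).
  { induction l as [|z l IH]; intros a b Hl; simpl in *.
    - subst b. ring.
    - destruct Hl as [_ Hl]. rewrite (IH z b Hl). field. }
  intros a l Hl. rewrite (K l a a Hl). ring.
Qed.

Lemma path_integral_lin (L : rhombic_lattice) (c : C) (f g : vertex L -> C)
    (a : vertex L) (l : list (vertex L)) :
  path_integral L (fun z => c * f z + g z) a l =
  c * path_integral L f a l + path_integral L g a l.
Proof.
  revert a. induction l as [|z l IH]; intros a; simpl; [ring|].
  rewrite IH. unfold Cdiv. ring.
Qed.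

Lemma discrete_analytic_lin (L : rhombic_lattice) (c : C) (f g : vertex L -> C) :
  discrete_analytic L f -> discrete_analytic L g ->
  discrete_analytic L (fun z => c * f z + g z).
Proof.
  intros Hf Hg a l Hl. rewrite path_integral_lin, (Hf a l Hl), (Hg a l Hl). ring.
Qed.

Lemma Zplus_lin (L : rhombic_lattice) (o : vertex L) (c : C) (f g : vertex L -> C)
    (z : vertex L) :
  discrete_analytic L f -> discrete_analytic L g ->
  Zplus L o (fun z => c * f z + g z) z = c * Zplus L o f z + Zplus L o g z.
Proof.
  intros Hf Hg. revert z. apply Zplus_unique.
  - apply discrete_analytic_lin; assumption.
  - rewrite !Zplus_origin by assumption. ring.
  - intros a b He.
    transitivity (c * (Zplus L o f b - Zplus L o f a) + (Zplus L o g b - Zplus L o g a));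
      [ring|].
    rewrite !Zplus_step by assumption. unfold Cdiv. ring.
Qed.

Fixpoint discrete_power (L : rhombic_lattice) (o : vertex L) (n : nat) : vertex L -> C :=
  match n with
  | O => fun _ => 1
  | S n => Zplus L o (discrete_power L o n)
  end.

Lemma discrete_power_analytic (L : rhombic_lattice) (o : vertex L) (n : nat) :
  discrete_analytic L (discrete_power L o n).
Proof.
  induction n as [|n IH]; simpl.
  - apply discrete_analytic_const.
  - apply Zplus_discrete_analytic, IH.
Qed.

Lemma discrete_power_1 (L : rhombic_lattice) (o z : vertex L) :
  point L o = RtoC 0 -> discrete_power L o 1 z = z.
Proof.
  intros Ho. simpl. revert z. apply Zplus_unique.
  - apply discrete_analytic_const.
  - exact Ho.
  - intros a b _. field.
Qed.

(** * Horizontal edges and tracks *)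

Lemma side_unit (r : rhombus) (a b : C) : side r a b -> Cmod (b - a) = 1%R.
Proof.
  intros (p & q & Hin & Hab).
  assert (K : Cmod (q - p) = 1%R).
  { simpl in Hin. destruct Hin as [E|[E|[E|[E|[]]]]]; injection E; intros <- <-.
    - replace (base r + dir1 r - base r) with (dir1 r) by ring. apply dir1_unit.
    - replace (base r + dir1 r + dir2 r - (base r + dir1 r)) with (dir2 r) by ring.
      apply dir2_unit.
    - replace (base r + dir2 r - (base r + dir1 r + dir2 r)) with (- dir1 r) by ring.
      rewrite Cmod_opp. apply dir1_unit.
    - replace (base r - (base r + dir2 r)) with (- dir2 r) by ring.
      rewrite Cmod_opp. apply dir2_unit. }
  destruct Hab as [[-> ->]|[-> ->]]; [exact K|].
  rewrite <- Cmod_opp. replace (- (p - q)) with (q - p) by ring. exact K.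
Qed.

(** [r] is the rhombus spanned at its corner [a] by the directions [1] and [d]. *)
Definition horizontal_frame (r : rhombus) (a d : C) : Prop :=
  Rabs (snd d) = height r /\ (-1 <= fst d <= 1)%R /\
  exists x y : R, (x = 0 \/ x = 1)%R /\ (y = 0 \/ y = 1)%R /\
    ((forall s t : R, cx r (a + s + t * d) = (x + (1 - 2 * x) * s)%R /\
                      cy r (a + s + t * d) = (y + (1 - 2 * y) * t)%R) \/
     (forall s t : R, cx r (a + s + t * d) = (x + (1 - 2 * x) * t)%R /\
                      cy r (a + s + t * d) = (y + (1 - 2 * y) * s)%R)).

Lemma horizontal_frame_exists (r : rhombus) (a : C) :
  side r a (a + 1) -> exists d, horizontal_frame r a d.
Proof.
  intros H. apply side_coords in H. destruct H as (Ha & Hb & Hab).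
  apply corner_coords in Ha, Hb. destruct Ha as [Hxa Hya], Hb as [Hxb Hyb].
  pose proof (cross_dirs_neq_0 r) as Hc.
  pose proof (unit_components _ (dir1_unit r)) as [U1 _].
  pose proof (unit_components _ (dir2_unit r)) as [U2 _].
  assert (Ea := at_coords_cx_cy r a). assert (Eb := at_coords_cx_cy r (a + 1)).
  destruct Hab as [[Hab N]|[N Hab]].
  (* The horizontal side runs along [dir2]. The signs [1 - 2 * x] and [1 - 2 * y] turn both
     directions away from the corner [a], so the signed [dir2] is 1 and the signed [dir1] is the
     direction of the frame. *)
  - set (x := cx r a) in *. set (y := cy r a) in *. rewrite <- Hab in Eb.
    set (y' := cy r (a + 1)) in *.
    assert (Hy' : y' = (1 - y)%R) by lra. rewrite Hy' in Eb.
    assert (E : RtoC (1 - 2 * y)%R * dir2 r = 1).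
    { replace (RtoC 1) with ((a + 1) - a) by ring. rewrite <- Eb, <- Ea.
      unfold at_coords. apply C_eq; simpl; ring. }
    assert (F1 := f_equal fst E). assert (F2 := f_equal snd E). simpl in F1, F2.
    assert (S2 : snd (dir2 r) = 0%R) by (destruct Hya as [Hya|Hya]; rewrite Hya in *; lra).
    exists (RtoC (1 - 2 * x)%R * dir1 r). split; [|split].
    + unfold height, cross. rewrite S2. simpl.
      replace ((1 - 2 * x) * snd (dir1 r) + 0 * fst (dir1 r))%R
        with ((1 - 2 * x) * snd (dir1 r))%R by ring.
      replace (fst (dir1 r) * 0 - snd (dir1 r) * fst (dir2 r))%R
        with (- (snd (dir1 r) * fst (dir2 r)))%R by ring.
      rewrite Rabs_Ropp, !Rabs_mult.
      assert (K1 : Rabs (1 - 2 * x) = 1%R).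
      { destruct Hxa as [-> | ->]; [rewrite Rabs_right|rewrite Rabs_left]; lra. }
      assert (K2 : Rabs (fst (dir2 r)) = 1%R).
      { destruct Hya as [Hya|Hya]; rewrite Hya in *; [rewrite Rabs_right|rewrite Rabs_left]; lra. }
      rewrite K1, K2. ring.
    + simpl. destruct Hxa as [-> | ->]; lra.
    + exists x, y. split; [exact Hxa|]. split; [exact Hya|]. right. intros s t.
      replace (a + s + t * (RtoC (1 - 2 * x)%R * dir1 r))
        with (at_coords r (x + (1 - 2 * x) * t) (y + (1 - 2 * y) * s)).
      * rewrite cx_at_coords, cy_at_coords. auto.
      * transitivity (at_coords r x y + s * (RtoC (1 - 2 * y)%R * dir2 r) +
          t * (RtoC (1 - 2 * x)%R * dir1 r)).
        -- unfold at_coords. apply C_eq; simpl; ring.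
        -- rewrite E, Ea. ring.
  - set (x := cx r a) in *. set (y := cy r a) in *. rewrite <- Hab in Eb.
    set (x' := cx r (a + 1)) in *.
    assert (Hx' : x' = (1 - x)%R) by lra. rewrite Hx' in Eb.
    assert (E : RtoC (1 - 2 * x)%R * dir1 r = 1).
    { replace (RtoC 1) with ((a + 1) - a) by ring. rewrite <- Eb, <- Ea.
      unfold at_coords. apply C_eq; simpl; ring. }
    assert (F1 := f_equal fst E). assert (F2 := f_equal snd E). simpl in F1, F2.
    assert (S2 : snd (dir1 r) = 0%R) by (destruct Hxa as [Hxa|Hxa]; rewrite Hxa in *; lra).
    exists (RtoC (1 - 2 * y)%R * dir2 r). split; [|split].
    + unfold height, cross. rewrite S2. simpl.
      replace ((1 - 2 * y) * snd (dir2 r) + 0 * fst (dir2 r))%R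
        with ((1 - 2 * y) * snd (dir2 r))%R by ring.
      replace (fst (dir1 r) * snd (dir2 r) - 0 * fst (dir2 r))%R
        with (fst (dir1 r) * snd (dir2 r))%R by ring.
      rewrite !Rabs_mult.
      assert (K1 : Rabs (1 - 2 * y) = 1%R).
      { destruct Hya as [-> | ->]; [rewrite Rabs_right|rewrite Rabs_left]; lra. }
      assert (K2 : Rabs (fst (dir1 r)) = 1%R).
      { destruct Hxa as [Hxa|Hxa]; rewrite Hxa in *; [rewrite Rabs_right|rewrite Rabs_left]; lra. }
      rewrite K1, K2. ring.
    + simpl. destruct Hya as [-> | ->]; lra.
    + exists x, y. split; [exact Hxa|]. split; [exact Hya|]. left. intros s t.
      replace (a + s + t * (RtoC (1 - 2 * y)%R * dir2 r))
        with (at_coords r (x + (1 - 2 * x) * s) (y + (1 - 2 * y) * t)).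
      * rewrite cx_at_coords, cy_at_coords. auto.
      * transitivity (at_coords r x y + s * (RtoC (1 - 2 * x)%R * dir1 r) +
          t * (RtoC (1 - 2 * y)%R * dir2 r)).
        -- unfold at_coords. apply C_eq; simpl; ring.
        -- rewrite E, Ea. ring.
Qed.

Lemma frame_region (r : rhombus) (a d : C) (s t : R) :
  horizontal_frame r a d ->
  region r (a + s + t * d) <-> (0 <= s <= 1)%R /\ (0 <= t <= 1)%R.
Proof.
  intros (_ & _ & x & y & Hx & Hy & [H|H]); destruct (H s t) as [E1 E2];
    rewrite region_coords, E1, E2; destruct Hx as [-> | ->], Hy as [-> | ->]; lra.
Qed.

Lemma frame_interior (r : rhombus) (a d : C) (s t : R) :
  horizontal_frame r a d -> (0 < s < 1)%R -> (0 < t < 1)%R ->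
  (0 < cx r (a + s + t * d) < 1)%R /\ (0 < cy r (a + s + t * d) < 1)%R.
Proof.
  intros (_ & _ & x & y & Hx & Hy & [H|H]) Hs Ht; destruct (H s t) as [E1 E2];
    rewrite E1, E2; destruct Hx as [-> | ->], Hy as [-> | ->]; lra.
Qed.

Lemma frame_flip (r : rhombus) (a d : C) :
  horizontal_frame r a d -> horizontal_frame r (a + d) (- d).
Proof.
  intros (Hh & Hd & x & y & Hx & Hy & H). split; [|split].
  - simpl. rewrite Rabs_Ropp. exact Hh.
  - simpl. lra.
  - assert (E : forall s t : R, a + d + s + t * - d = a + s + (1 - t)%R * d)
      by (intros; apply C_eq; simpl; ring).
    destruct H as [H|H].
    + exists x, (1 - y)%R. split; [exact Hx|]. split; [lra|]. left. intros s t.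
      rewrite E. destruct (H s (1 - t)%R) as [-> ->]. split; ring.
    + exists (1 - x)%R, y. split; [lra|]. split; [exact Hy|]. right. intros s t.
      rewrite E. destruct (H s (1 - t)%R) as [-> ->]. split; ring.
Qed.

Lemma frame_sides (r : rhombus) (a d : C) :
  horizontal_frame r a d -> side r a (a + 1) /\ side r a (a + d).
Proof.
  intros (Hh & Hd & x & y & Hx & Hy & H).
  assert (K : exists s t s' t' : R,
    (cx r a = x /\ cy r a = y) /\ (cx r (a + 1) = s /\ cy r (a + 1) = t) /\
    (cx r (a + d) = s' /\ cy r (a + d) = t') /\
    ((s = 1 - x /\ t = y /\ s' = x /\ t' = 1 - y)%R \/
     (s = x /\ t = 1 - y /\ s' = 1 - x /\ t' = y)%R)).
  { replace (a + 1) with (a + 1%R + 0%R * d) by (apply C_eq; simpl; ring).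
    replace (a + d) with (a + 0%R + 1%R * d) by (apply C_eq; simpl; ring).
    exists (cx r (a + 1%R + 0%R * d)), (cy r (a + 1%R + 0%R * d)),
      (cx r (a + 0%R + 1%R * d)), (cy r (a + 0%R + 1%R * d)).
    split; [|split; [auto|split; [auto|]]].
    - replace a with (a + 0%R + 0%R * d) by (apply C_eq; simpl; ring).
      destruct H as [H|H]; destruct (H 0%R 0%R) as [-> ->]; split; ring.
    - destruct H as [H|H]; destruct (H 1%R 0%R) as [-> ->], (H 0%R 1%R) as [-> ->];
        [left|right]; repeat split; ring. }
  destruct K as (s & t & s' & t' & [E1 E2] & [E3 E4] & [E5 E6] & K).
  rewrite !side_coords, !corner_coords, E1, E2, E3, E4, E5, E6.
  destruct Hx as [-> | ->], Hy as [-> | ->]; lra.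
Qed.

Lemma midpoint_segment (a : C) : segment a (a + 1) (a + (1 / 2)%R).
Proof. exists (1 / 2)%R. split; [lra|]. apply C_eq; simpl; ring. Qed.

Lemma midpoint_not_vertex (L : rhombic_lattice) (a : C) :
  edge L a (a + 1) -> ~ is_vertex L (a + (1 / 2)%R).
Proof.
  intros (i & Hi) Hv.
  pose proof (midpoint_segment a) as Hs.
  assert (Hc := vertex_in_face L i _ Hv (side_segment_region _ _ _ _ Hi Hs)).
  destruct (corner_in_side _ _ _ _ Hi Hc Hs) as [E|E]; apply (f_equal fst) in E; simpl in E; lra.
Qed.

Lemma frame_height (r : rhombus) (a d : C) :
  horizontal_frame r a d -> snd d = height r \/ snd d = (- height r)%R.
Proof.
  intros (H & _). unfold Rabs in H. destruct (Rcase_abs (snd d)); lra.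
Qed.

(** A point slightly above or below the midpoint of the edge lies in a face that contains the
    midpoint and hence has the edge as a side. Its frame direction has the sign [e], for otherwise
    the point would have a negative coordinate. *)
Lemma face_beside (L : rhombic_lattice) (a : C) (e : R) :
  edge L a (a + 1) -> (e = 1 \/ e = -1)%R ->
  exists (i : face L) (d : C), horizontal_frame (L i) a d /\ snd d = (e * height (L i))%R.
Proof.
  intros Ha He. destruct (local_star L (a + (1 / 2)%R)) as (g & Hg & H).
  set (q := a + (1 / 2)%R + (0, e * (g / 2))%R).
  assert (Hq : near g (a + (1 / 2)%R) q).
  { unfold q. split; simpl; apply Rabs_def1; destruct He as [-> | ->]; lra. }
  destruct (faces_cover L q) as (i & Hi).
  assert (Hm := H i q Hq Hi).
  assert (Hs := edge_in_face L i _ _ _ Ha (midpoint_segment a) (midpoint_not_vertex L a Ha) Hm).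
  destruct (horizontal_frame_exists _ _ Hs) as (d & Hd). exists i, d. split; [exact Hd|].
  pose proof (height_pos (L i)) as Hh.
  destruct (frame_height _ _ _ Hd) as [E|E], He as [-> | ->]; try lra; exfalso.
  - set (t := (-1 * (g / 2) / snd d)%R).
    assert (Ht : (t * snd d = -1 * (g / 2))%R) by (unfold t; field; lra).
    assert (Eq : q = a + (1 / 2 - t * fst d)%R + t * d).
    { unfold q. apply C_eq; simpl; [ring|]. rewrite Ht. ring. }
    rewrite Eq in Hi. apply (frame_region _ _ _ _ _ Hd) in Hi. rewrite E in Ht. nra.
  - set (t := (1 * (g / 2) / snd d)%R).
    assert (Ht : (t * snd d = 1 * (g / 2))%R) by (unfold t; field; lra).
    assert (Eq : q = a + (1 / 2 - t * fst d)%R + t * d).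
    { unfold q. apply C_eq; simpl; [ring|]. rewrite Ht. ring. }
    rewrite Eq in Hi. apply (frame_region _ _ _ _ _ Hd) in Hi. rewrite E in Ht. nra.
Qed.

(** At the ordinate of [a + d] the leftmost point of the rhombus is [a + d], and likewise it is
    [a + d']. *)
Lemma frame_unique_in_face (r : rhombus) (a d d' : C) :
  horizontal_frame r a d -> horizontal_frame r a d' -> snd d = snd d' -> d = d'.
Proof.
  intros H H' E. apply C_eq; [|exact E].
  assert (K : forall d d', horizontal_frame r a d -> horizontal_frame r a d' ->
    snd d = snd d' -> (fst d <= fst d')%R).
  { clear. intros d d' H H' E.
    assert (R : region r (a + 0%R + 1%R * d')) by (apply (frame_region _ _ _ _ _ H'); lra).
    replace (a + 0%R + 1%R * d') with (a + (fst d' - fst d)%R + 1%R * d) in R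
      by (apply C_eq; simpl; rewrite ?E; ring).
    apply (frame_region _ _ _ _ _ H) in R. lra. }
  apply Rle_antisym; apply K; auto.
Qed.

(** Faces on the same side of a tie overlap near its midpoint: frame directions have horizontal
    components of modulus at most 1, so the point with frame coordinates 1/2 and 1/8 in one face
    lies in the other one too. *)
Lemma frame_unique (L : rhombic_lattice) (i j : face L) (a d d' : C) :
  horizontal_frame (L i) a d -> horizontal_frame (L j) a d' -> snd d = snd d' -> d = d'.
Proof.
  intros Hi Hj E.
  assert (Eij : j = i).
  { pose proof Hi as (_ & Bd & _). pose proof Hj as (_ & Bd' & _).
    apply interior_one_face with (p := a + (1 / 2)%R + (1 / 8)%R * d).
    - replace (a + (1 / 2)%R + (1 / 8)%R * d) with
        (a + (1 / 2 + 1 / 8 * (fst d - fst d'))%R + (1 / 8)%R * d')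
        by (apply C_eq; simpl; rewrite ?E; ring).
      apply (frame_region _ _ _ _ _ Hj). lra.
    - apply frame_interior; [exact Hi|lra|lra].
    - apply frame_interior; [exact Hi|lra|lra]. }
  rewrite Eij in Hj. apply (frame_unique_in_face (L i) a); assumption.
Qed.

(** The ties of [F] are the edges from [a n] to [a n + 1], listed upwards. *)
Definition horizontal_track (L : rhombic_lattice) (F : Z -> face L) (a : Z -> C) : Prop :=
  forall n : Z, horizontal_frame (L (F n)) (a n) (a (n + 1)%Z - a n) /\
    (0 < snd (a (n + 1)%Z) - snd (a n))%R.

Lemma horizontal_track_exists (L : rhombic_lattice) (c : C) :
  edge L c (c + 1) -> exists F a, horizontal_track L F a /\ a 0%Z = c.
Proof.
  intros Hc.
  (* [f] and [nx] give the next face and the left end of its far tie, upwards for [e = 1] and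
     downwards for [e = -1]. *)
  assert (Step : forall e, (e = 1 \/ e = -1)%R ->
    exists (f : C -> face L) (nx : C -> C), forall a, edge L a (a + 1) ->
      horizontal_frame (L (f a)) a (nx a - a) /\ (0 < e * (snd (nx a) - snd a))%R /\
      edge L (nx a) (nx a + 1)).
  { intros e He.
    assert (K : forall a, exists p : face L * C, edge L a (a + 1) ->
      horizontal_frame (L (fst p)) a (snd p - a) /\ (0 < e * (snd (snd p) - snd a))%R /\
      edge L (snd p) (snd p + 1)).
    { intros a. destruct (faces_cover L a) as (i0 & _).
      destruct (excluded_middle_informative (edge L a (a + 1))) as [Ha|Ha].
      - destruct (face_beside L a e Ha He) as (i & d & Hd & Ed).
        exists (i, a + d). intros _. simpl fst. simpl snd at 1 3 4.
        replace (a + d - a) with d by ring. split; [exact Hd|]. split.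
        + simpl. pose proof (height_pos (L i)). destruct He as [-> | ->]; lra.
        + exists i. apply (frame_sides _ _ _ (frame_flip _ _ _ Hd)).
      - exists (i0, a). tauto. }
    set (p := fun a => proj1_sig (constructive_indefinite_description _ (K a))).
    exists (fun a => fst (p a)), (fun a => snd (p a)). intros a.
    exact (proj2_sig (constructive_indefinite_description _ (K a))). }
  destruct (Step 1%R) as (fu & up & Hup); [auto|].
  destruct (Step (-1)%R) as (fd & dn & Hdn); [auto|].
  set (it := fun (g : C -> C) (n : nat) => Nat.iter n g c).
  assert (Iu : forall n, edge L (it up n) (it up n + 1)).
  { induction n; [exact Hc|]. simpl. apply Hup, IHn. }
  assert (Id : forall n, edge L (it dn n) (it dn n + 1)).
  { induction n; [exact Hc|]. simpl. apply Hdn, IHn. }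
  set (a := fun z : Z => match z with
    | Z0 => c | Zpos p => it up (Pos.to_nat p) | Zneg p => it dn (Pos.to_nat p) end).
  assert (Au : forall n : nat, a (Z.of_nat n) = it up n).
  { intros [|n]; [reflexivity|].
    change (it up (Pos.to_nat (Pos.of_succ_nat n)) = it up (S n)).
    rewrite SuccNat2Pos.id_succ. reflexivity. }
  assert (Ad : forall n : nat, a (- Z.of_nat n)%Z = it dn n).
  { intros [|n]; [reflexivity|].
    change (it dn (Pos.to_nat (Pos.of_succ_nat n)) = it dn (S n)).
    rewrite SuccNat2Pos.id_succ. reflexivity. }
  (* At a negative index the face was found from its upper tie, which has the index [z + 1]. *)
  exists (fun z => if Z_le_dec 0 z then fu (a z) else fd (a (z + 1)%Z)), a.
  split; [|reflexivity].
  intros z. destruct (Z_le_dec 0 z) as [Hz|Hz].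
  - destruct (Z_of_nat_complete z Hz) as (n & ->).
    replace (Z.of_nat n + 1)%Z with (Z.of_nat (S n)) by lia. rewrite !Au.
    destruct (Hup _ (Iu n)) as (H1 & H2 & _). simpl. split; [exact H1|].
    unfold it in *. lra.
  - destruct (Z_of_nat_complete (- z - 1) ltac:(lia)) as (n & Hn).
    replace (z + 1)%Z with (- Z.of_nat n)%Z by lia.
    replace z with (- Z.of_nat (S n))%Z by lia. rewrite !Ad.
    destruct (Hdn _ (Id n)) as (H1 & H2 & _). simpl.
    apply frame_flip in H1. fold (it dn n) in *.
    replace (it dn n + (dn (it dn n) - it dn n)) with (dn (it dn n)) in H1 by ring.
    replace (it dn n - dn (it dn n)) with (- (dn (it dn n) - it dn n)) by ring.
    split; [exact H1|]. lra.
Qed.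

Lemma track_frame (L : rhombic_lattice) (F : Z -> face L) (a : Z -> C)
    (HF : horizontal_track L F a) (n : Z) :
  horizontal_frame (L (F n)) (a n) (a (n + 1)%Z - a n).
Proof. apply HF. Qed.

Lemma track_frame_below (L : rhombic_lattice) (F : Z -> face L) (a : Z -> C)
    (HF : horizontal_track L F a) (n : Z) :
  horizontal_frame (L (F n)) (a (n + 1)%Z) (a n - a (n + 1)%Z).
Proof.
  pose proof (frame_flip _ _ _ (track_frame L F a HF n)) as H.
  replace (a n + (a (n + 1)%Z - a n)) with (a (n + 1)%Z) in H by ring.
  replace (- (a (n + 1)%Z - a n)) with (a n - a (n + 1)%Z) in H by ring. exact H.
Qed.

Lemma track_rise (L : rhombic_lattice) (F : Z -> face L) (a : Z -> C)
    (HF : horizontal_track L F a) (i : face L) (n : Z) :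
  snd (a (n + 1)%Z - a n) = height (L i).
Proof.
  destruct (HF n) as [H H']. rewrite (height_const L i (F n)).
  pose proof (height_pos (L (F n))).
  destruct (frame_height _ _ _ H) as [E|E]; [exact E|]. simpl in *. lra.
Qed.

(** Otherwise a point two heights above the tie at [a n] would lie in the face [F n]. *)
Lemma track_faces_distinct (L : rhombic_lattice) (F : Z -> face L) (a : Z -> C)
    (HF : horizontal_track L F a) (n : Z) :
  F n <> F (n + 1)%Z.
Proof.
  intros E. pose proof (track_frame L F a HF (n + 1)) as H. rewrite <- E in H.
  pose proof (track_rise L F a HF (F n) n) as R1.
  pose proof (track_rise L F a HF (F n) (n + 1)) as R2.
  pose proof (height_pos (L (F n))).
  assert (K : region (L (F n)) (a (n + 1)%Z + 0%R + 1%R * (a (n + 1 + 1)%Z - a (n + 1)%Z)))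
    by (apply (frame_region _ _ _ _ _ H); lra).
  replace (a (n + 1)%Z + 0%R + 1%R * (a (n + 1 + 1)%Z - a (n + 1)%Z)) with
    (a n + (fst (a (n + 1 + 1)%Z) - fst (a n) - 2 * fst (a (n + 1)%Z - a n)%C)%R +
     2%R * (a (n + 1)%Z - a n)) in K.
  - apply (frame_region _ _ _ _ _ (track_frame L F a HF n)) in K. lra.
  - apply C_eq; simpl in *; lra.
Qed.

Lemma track_shared_edge (L : rhombic_lattice) (F : Z -> face L) (a : Z -> C)
    (HF : horizontal_track L F a) (n : Z) :
  shared_edge L (F n) (F (n + 1)%Z) (a (n + 1)%Z) (a (n + 1)%Z + 1).
Proof.
  split; [apply (track_faces_distinct L F a HF)|]. split.
  - apply (frame_sides _ _ _ (track_frame_below L F a HF n)).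
  - apply (frame_sides _ _ _ (track_frame L F a HF (n + 1))).
Qed.

Lemma track_tie (L : rhombic_lattice) (F : Z -> face L) (a : Z -> C)
    (HF : horizontal_track L F a) (n : Z) :
  tie L F (a n) (a n + 1).
Proof.
  exists (n - 1)%Z. pose proof (track_shared_edge L F a HF (n - 1)) as H.
  replace (n - 1 + 1)%Z with n in H by ring. replace (n - 1 + 1)%Z with n by ring. exact H.
Qed.

Lemma horizontal_track_is_track (L : rhombic_lattice) (F : Z -> face L) (a : Z -> C)
    (HF : horizontal_track L F a) :
  is_track L F.
Proof.
  intros n. exists (a (n + 1)%Z), (a (n + 1)%Z + 1), (a n), (a n + 1).
  pose proof (track_shared_edge L F a HF n) as H1.
  pose proof (track_shared_edge L F a HF (n - 1)) as H2.
  replace (n - 1 + 1)%Z with n in H2 by ring.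
  destruct H2 as (H2 & H3 & H4).
  split; [exact H1|]. split; [repeat split; auto|].
  split; [apply H1|]. split; [exact H4|].
  destruct (HF n) as [_ Hn].
  repeat split; intros E; apply (f_equal snd) in E; simpl in E; lra.
Qed.

(** * Midlines of tracks *)

Lemma piecewise_linear (x : Z -> R) :
  exists m : R -> R, Ranalysis1.continuity m /\
    forall n t, (0 <= t < 1)%R -> m (IZR n + t)%R = (x n + t * (x (n + 1)%Z - x n))%R.
Proof.
  set (m := fun u : R =>
    (x (Int_part u) + (u - IZR (Int_part u)) * (x (Int_part u + 1)%Z - x (Int_part u)))%R).
  assert (Hm : forall n t, (0 <= t < 1)%R ->
    m (IZR n + t)%R = (x n + t * (x (n + 1)%Z - x n))%R).
  { intros n t Ht. unfold m.
    assert (E : Int_part (IZR n + t) = n).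
    { symmetry. apply Int_part_spec. lra. }
    rewrite E. ring. }
  exists m. split; [|exact Hm].
  intros u. destruct (base_Int_part u) as [B1 B2]. set (n := Int_part u) in *.
  (* Close to the integer [n] both linear pieces are given by one formula with an absolute value,
     which is continuous. *)
  set (k := fun v : R => (x n + (v - IZR n - Rabs (v - IZR n)) / 2 * (x n - x (n - 1)%Z)
    + (v - IZR n + Rabs (v - IZR n)) / 2 * (x (n + 1)%Z - x n))%R).
  assert (Hk : forall v, (IZR n - 1 < v < IZR n + 1)%R -> k v = m v).
  { intros v Hv. unfold k. destruct (Rle_dec (IZR n) v) as [Hle|Hle].
    - rewrite Rabs_right by lra.
      replace (m v) with (m (IZR n + (v - IZR n))%R) by (f_equal; ring).
      rewrite Hm by lra. field.
    - rewrite Rabs_left by lra.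
      replace (m v) with (m (IZR (n - 1) + (v - IZR n + 1))%R)
        by (rewrite minus_IZR; f_equal; ring).
      rewrite Hm by lra. replace (n - 1 + 1)%Z with n by ring. field. }
  apply (continuity_pt_ext_loc k).
  - exists (mkposreal (Rmin (u - (IZR n - 1)) (IZR n + 1 - u))
      ltac:(apply Rmin_glb_lt; lra)).
    intros v Hv. apply Hk. change (Rabs (v - u) < Rmin (u - (IZR n - 1)) (IZR n + 1 - u))%R in Hv.
    pose proof (Rmin_l (u - (IZR n - 1)) (IZR n + 1 - u)).
    pose proof (Rmin_r (u - (IZR n - 1)) (IZR n + 1 - u)).
    apply Rabs_def2 in Hv. lra.
  - unfold k. reg.
Qed.

(** The polygonal line through the midpoints of the ties, as the graph of the abscissa over the
    ordinate. *)
Definition midline (a : Z -> C) (m : R -> R) : Prop :=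
  Ranalysis1.continuity m /\
  (forall n : Z, m (snd (a n)) = (fst (a n) + 1 / 2)%R) /\
  (forall y : R, exists (n : Z) (t : R), (0 <= t < 1)%R /\
     ((m y, y) : C) = a n + (1 / 2)%R + t * (a (n + 1)%Z - a n)).

(** All faces have the same height, so the ordinates of the ties form an arithmetic progression, and
    the midline is a graph over the whole vertical axis. *)
Lemma midline_exists (L : rhombic_lattice) (F : Z -> face L) (a : Z -> C) :
  horizontal_track L F a -> exists m, midline a m.
Proof.
  intros HF.
  set (h := height (L (F 0%Z))). assert (Hh : (0 < h)%R) by apply height_pos.
  assert (Hstep : forall n, snd (a (n + 1)%Z) = (snd (a n) + h)%R).
  { intros n. pose proof (track_rise L F a HF (F 0%Z) n) as E. simpl in E. unfold h. lra. }
  assert (Hlin : forall n, snd (a n) = (snd (a 0%Z) + IZR n * h)%R).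
  { apply (Z.bi_induction (fun n => snd (a n) = (snd (a 0%Z) + IZR n * h)%R)).
    - intros n n' ->. reflexivity.
    - simpl. ring.
    - intros n. unfold Z.succ. rewrite Hstep, plus_IZR. lra. }
  destruct (piecewise_linear (fun n => fst (a n) + 1 / 2)%R) as (m & Cm & Hm).
  exists (fun y => m ((y - snd (a 0%Z)) / h)%R). split; [|split].
  - intros y. apply (continuity_pt_comp (fun y => ((y - snd (a 0%Z)) / h)%R) m).
    + unfold Rdiv. apply continuity_pt_mult; [reg|].
      apply continuity_pt_const. intros x z. reflexivity.
    + apply Cm.
  - intros n. replace ((snd (a n) - snd (a 0%Z)) / h)%R with (IZR n + 0)%R
      by (rewrite Hlin; field; lra).
    rewrite Hm by lra. ring.
  - intros y. destruct (base_Int_part ((y - snd (a 0%Z)) / h)) as [B1 B2].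
    set (u := ((y - snd (a 0%Z)) / h)%R) in *.
    exists (Int_part u), (u - IZR (Int_part u))%R. split; [lra|].
    replace (m u) with (m (IZR (Int_part u) + (u - IZR (Int_part u)))%R) by (f_equal; ring).
    rewrite Hm by lra. apply C_eq; simpl; [ring|].
    rewrite Hstep, Hlin. replace y with (u * h + snd (a 0%Z))%R at 1 by (unfold u; field; lra).
    ring.
Qed.

(** The edge meets the midline by the intermediate value theorem. No edge passes through the
    interior of a face, so the common point is the midpoint of a tie, and the edge is this tie. *)
Lemma midline_crossing (L : rhombic_lattice) (F : Z -> face L) (a : Z -> C) (m : R -> R)
    (u v : C) :
  horizontal_track L F a -> midline a m -> edge L u v ->
  (m (snd u) < fst u)%R -> ~ (m (snd v) < fst v)%R ->
  exists n, (a n = u /\ a n + 1 = v) \/ (a n = v /\ a n + 1 = u).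
Proof.
  intros HF (Cm & _ & Hm) He Hu Hv.
  set (g := fun s : R => (fst u + s * (fst v - fst u) - m (snd u + s * (snd v - snd u)))%R).
  assert (Cg : Ranalysis1.continuity g).
  { intros s. unfold g. apply continuity_pt_minus; [reg|].
    apply (continuity_pt_comp (fun s => (snd u + s * (snd v - snd u))%R) m); [reg|apply Cm]. }
  assert (G0 : (0 < g 0)%R).
  { unfold g. rewrite !Rmult_0_l, !Rplus_0_r. lra. }
  assert (G1 : (g 1 <= 0)%R).
  { unfold g. rewrite !Rmult_1_l. replace (fst u + (fst v - fst u))%R with (fst v) by ring.
    replace (snd u + (snd v - snd u))%R with (snd v) by ring. lra. }
  destruct (IVT_gen g 0 1 0 Cg) as (s & Hs & Es).
  { rewrite Rmin_right, Rmax_left by lra. lra. }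
  rewrite Rmin_left, Rmax_right in Hs by lra.
  set (y := (snd u + s * (snd v - snd u))%R) in *.
  assert (Ep : u + s * (v - u) = (m y, y)).
  { unfold g in Es. fold y in Es. apply C_eq; simpl; [lra|unfold y; ring]. }
  assert (Hp : segment u v (m y, y)) by (exists s; auto).
  destruct (Hm y) as (n & t & Ht & E). rewrite E in Hp.
  pose proof (track_frame L F a HF n) as Fr.
  destruct (Req_dec t 0) as [-> |Nt].
  - replace (a n + (1 / 2)%R + 0%R * (a (n + 1)%Z - a n)) with (a n + (1 / 2)%R) in Hp
      by (apply C_eq; simpl; ring).
    destruct (frame_sides _ _ _ Fr) as [Sn _].
    pose proof (side_segment_region _ _ _ _ Sn (midpoint_segment (a n))) as Rn.
    pose proof (midpoint_not_vertex L (a n) (ex_intro _ (F n) Sn)) as Nv.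
    pose proof (edge_in_face L (F n) u v _ He Hp Nv Rn) as Su.
    exists n. apply (sides_through_point (L (F n)) _ _ _ _ _ Sn Su (midpoint_segment (a n)) Hp).
    intros N. apply Nv. exists (F n). exact N.
  - exfalso. destruct He as (k & Hk).
    destruct (frame_interior _ _ _ (1 / 2) t Fr ltac:(lra) ltac:(lra)) as [I1 I2].
    pose proof (interior_one_face L k (F n) _ (side_segment_region _ _ _ _ Hk Hp) I1 I2) as Ek.
    rewrite Ek in Hk. apply (side_boundary _ _ _ _ Hk Hp). auto.
Qed.

(** In the frame of [F], the lower tie and the upper left corner from the other frame have
    coordinates among [s], [s + 1] and [t], [t + 1]. The rhombus forces these into the unit
    interval, so [s] and [t] vanish. *)
Lemma track_same_face (L : rhombic_lattice) (F F' : Z -> face L) (a a' : Z -> C) (n n' : Z) :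
  horizontal_track L F a -> horizontal_track L F' a' -> F n = F' n' -> a n = a' n'.
Proof.
  intros HF HF' E.
  pose proof (track_frame L F a HF n) as H. pose proof (track_frame L F' a' HF' n') as H'.
  rewrite <- E in H'.
  pose proof (track_rise L F a HF (F n) n) as R1.
  pose proof (track_rise L F' a' HF' (F n) n') as R2.
  pose proof (height_pos (L (F n))) as Hh.
  set (d := a (n + 1)%Z - a n) in *. set (d' := a' (n' + 1)%Z - a' n') in *.
  clearbody d d'.
  set (t := ((snd (a' n') - snd (a n)) / snd d)%R).
  assert (Et : (snd (a' n') = snd (a n) + t * snd d)%R) by (unfold t; field; lra).
  set (s := (fst (a' n') - fst (a n) - t * fst d)%R).
  assert (E0 : a' n' = a n + s + t * d).
  { apply C_eq; simpl; [unfold s; ring|]. rewrite Et. ring. }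
  assert (K0 : region (L (F n)) (a n + s + t * d)).
  { rewrite <- E0. replace (a' n') with (a' n' + 0%R + 0%R * d') by (apply C_eq; simpl; ring).
    apply (frame_region _ _ _ _ _ H'). lra. }
  assert (K1 : region (L (F n)) (a n + (s + 1)%R + t * d)).
  { replace (a n + (s + 1)%R + t * d) with (a n + s + t * d + 1)
      by (apply C_eq; simpl; ring).
    rewrite <- E0. replace (a' n' + 1) with (a' n' + 1%R + 0%R * d') by (apply C_eq; simpl; ring).
    apply (frame_region _ _ _ _ _ H'). lra. }
  assert (K2 : region (L (F n)) (a n + (s + fst d' - fst d)%R + (t + 1)%R * d)).
  { replace (a n + (s + fst d' - fst d)%R + (t + 1)%R * d) with (a n + s + t * d + d')
      by (apply C_eq; simpl; rewrite ?R1, ?R2; ring).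
    rewrite <- E0. replace (a' n' + d') with (a' n' + 0%R + 1%R * d') by (apply C_eq; simpl; ring).
    apply (frame_region _ _ _ _ _ H'). lra. }
  apply (frame_region _ _ _ _ _ H) in K0, K1, K2.
  assert (Es : s = 0%R) by lra. assert (Et' : t = 0%R) by lra.
  rewrite E0, Es, Et'. apply C_eq; simpl; ring.
Qed.

(** The common point is the midpoint of a tie of both tracks, or it is interior to a face, which
    then belongs to both. *)
Lemma midlines_meet (L : rhombic_lattice) (F F' : Z -> face L) (a a' : Z -> C)
    (m m' : R -> R) (y : R) :
  horizontal_track L F a -> horizontal_track L F' a' -> midline a m -> midline a' m' ->
  m y = m' y -> exists n n', a n = a' n'.
Proof.
  intros HF HF' (_ & _ & Hm) (_ & _ & Hm') E.
  destruct (Hm y) as (n & t & Ht & En), (Hm' y) as (n' & t' & Ht' & En').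
  rewrite <- E, En in En'. exists n, n'.
  pose proof (track_frame L F a HF n) as H. pose proof (track_frame L F' a' HF' n') as H'.
  assert (R : region (L (F n)) (a n + (1 / 2)%R + t * (a (n + 1)%Z - a n)))
    by (apply (frame_region _ _ _ _ _ H); lra).
  assert (R' : region (L (F' n')) (a' n' + (1 / 2)%R + t' * (a' (n' + 1)%Z - a' n')))
    by (apply (frame_region _ _ _ _ _ H'); lra).
  destruct (Req_dec t 0) as [-> |Nt]; [destruct (Req_dec t' 0) as [-> |Nt']|].
  - apply (f_equal (fun z => z - (1 / 2)%R)) in En'.
    replace (a n) with (a n + (1 / 2)%R + 0%R * (a (n + 1)%Z - a n) - (1 / 2)%R)
      by (apply C_eq; simpl; ring).
    rewrite En'. apply C_eq; simpl; ring.
  - apply (track_same_face L F F'); try assumption.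
    rewrite En' in R.
    destruct (frame_interior _ _ _ (1 / 2) t' H' ltac:(lra) ltac:(lra)) as [I1 I2].
    apply (interior_one_face L _ _ _ R I1 I2).
  - apply (track_same_face L F F'); try assumption.
    rewrite <- En' in R'.
    destruct (frame_interior _ _ _ (1 / 2) t H ltac:(lra) ltac:(lra)) as [I1 I2].
    symmetry. apply (interior_one_face L _ _ _ R' I1 I2).
Qed.

(** The frame at a tie determines the neighbouring tie, upwards and downwards, so a common tie
    propagates along the tracks. *)
Lemma track_unique (L : rhombic_lattice) (F F' : Z -> face L) (a a' : Z -> C) (n n' k : Z) :
  horizontal_track L F a -> horizontal_track L F' a' -> a n = a' n' ->
  a (n + k)%Z = a' (n' + k)%Z.
Proof.
  intros HF HF' E. revert k.
  apply (Z.bi_induction (fun k => a (n + k)%Z = a' (n' + k)%Z)).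
  - intros k k' ->. reflexivity.
  - rewrite !Z.add_0_r. exact E.
  - intros k. unfold Z.succ. rewrite !Z.add_assoc.
    set (p := (n + k)%Z). set (p' := (n' + k)%Z).
    pose proof (track_rise L F a HF (F p) p) as R1.
    pose proof (track_rise L F' a' HF' (F p) p') as R2.
    split; intros Ep.
    + pose proof (track_frame L F a HF p) as H. pose proof (track_frame L F' a' HF' p') as H'.
      rewrite Ep in H, R1.
      pose proof (frame_unique L _ _ _ _ _ H H' ltac:(congruence)) as Ed.
      replace (a (p + 1)%Z) with (a (p + 1)%Z - a' p' + a' p') by ring. rewrite Ed. ring.
    + pose proof (track_frame_below L F a HF p) as H.
      pose proof (track_frame_below L F' a' HF' p') as H'.
      rewrite Ep in H, R1.
      assert (Es : snd (a p - a' (p' + 1)%Z) = snd (a' p' - a' (p' + 1)%Z)).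
      { simpl in *. lra. }
      pose proof (frame_unique L _ _ _ _ _ H H' Es) as Ed.
      replace (a p) with (a p - a' (p' + 1)%Z + a' (p' + 1)%Z) by ring. rewrite Ed. ring.
Qed.

(** * The kernel of the shift *)

Definition slanted_edge (L : rhombic_lattice) (u v : C) : Prop :=
  edge L u v /\ v - u <> 1 /\ u - v <> 1.

Definition slanted_connected (L : rhombic_lattice) : C -> C -> Prop :=
  clos_refl_trans C (slanted_edge L).

Lemma slanted_connected_sym (L : rhombic_lattice) (u v : C) :
  slanted_connected L u v -> slanted_connected L v u.
Proof.
  intros H. induction H as [u v (H1 & H2 & H3)| |u v w _ IH1 _ IH2].
  - apply rt_step. split; [apply edge_sym, H1|]. auto.
  - apply rt_refl.
  - apply rt_trans with v; assumption.
Qed.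

(** An edge that crosses the midline is a tie, and ties are not slanted. *)
Lemma slanted_same_side (L : rhombic_lattice) (F : Z -> face L) (a : Z -> C) (m : R -> R)
    (u v : C) :
  horizontal_track L F a -> midline a m -> slanted_connected L u v ->
  (m (snd u) < fst u)%R -> (m (snd v) < fst v)%R.
Proof.
  intros HF Hm H. induction H as [u v (He & N1 & N2)| |u v w _ IH1 _ IH2]; [|auto|auto].
  intros Hu. destruct (Rlt_dec (m (snd v)) (fst v)) as [|Hv]; [assumption|exfalso].
  destruct (midline_crossing L F a m u v HF Hm He Hu Hv) as (n & [[E1 E2]|[E1 E2]]).
  - apply N1. rewrite <- E2, <- E1. ring.
  - apply N2. rewrite <- E2, <- E1. ring.
Qed.

(** Each midline would be to the right of the other one somewhere, so the midlines cross. *)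
Lemma facing_tracks (L : rhombic_lattice) (F F' : Z -> face L) (a a' : Z -> C) :
  horizontal_track L F a -> horizontal_track L F' a' ->
  slanted_connected L (a 0%Z + 1) (a' 0%Z + 1) -> exists n, a' 0%Z = a n.
Proof.
  intros HF HF' Hc.
  destruct (midline_exists L F a HF) as (m & Hm).
  destruct (midline_exists L F' a' HF') as (m' & Hm').
  set (c := a 0%Z) in *. set (c' := a' 0%Z) in *.
  assert (Ec : m (snd c) = (fst c + 1 / 2)%R) by apply Hm.
  assert (Ec' : m' (snd c') = (fst c' + 1 / 2)%R) by apply Hm'.
  assert (Tie : forall n n', a n = a' n' -> exists n, c' = a n).
  { intros n n' E. exists (n + - n')%Z.
    rewrite (track_unique L F F' a a' n n' (- n') HF HF' E), Z.add_opp_diag_r.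
    reflexivity. }
  assert (Hh : edge L c (c + 1)).
  { exists (F 0%Z). apply (frame_sides _ _ _ (track_frame L F a HF 0)). }
  assert (Hh' : edge L c' (c' + 1)).
  { exists (F' 0%Z). apply (frame_sides _ _ _ (track_frame L F' a' HF' 0)). }
  assert (S1 : (m (snd (c' + 1)%C) < fst (c' + 1)%C)%R).
  { apply (slanted_same_side L F a m _ _ HF Hm Hc). simpl. rewrite Rplus_0_r. lra. }
  assert (S2 : (m' (snd (c + 1)%C) < fst (c + 1)%C)%R).
  { apply (slanted_same_side L F' a' m' _ _ HF' Hm' (slanted_connected_sym _ _ _ Hc)).
    simpl. rewrite Rplus_0_r. lra. }
  (* If [c'] is not to the right of [m], its horizontal edge crosses [m] and is a tie of [F]. The
     case of [c] and [m'] is symmetric. *)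
  destruct (Rlt_dec (m (snd c')) (fst c')) as [T1|T1].
  2:{ destruct (midline_crossing L F a m _ _ HF Hm (edge_sym _ _ _ Hh') S1 T1)
        as (n & [[E1 E2]|[E1 E2]]).
      - apply (f_equal fst) in E1, E2. simpl in E1, E2. lra.
      - exists n. auto. }
  destruct (Rlt_dec (m' (snd c)) (fst c)) as [T2|T2].
  2:{ destruct (midline_crossing L F' a' m' _ _ HF' Hm' (edge_sym _ _ _ Hh) S2 T2)
        as (n & [[E1 E2]|[E1 E2]]).
      - apply (f_equal fst) in E1, E2. simpl in E1, E2. lra.
      - apply (Tie 0%Z n). auto. }
  (* Now [m] is less than [m'] at the ordinate of [c'], and [m'] is less than [m] at that of [c]. *)
  destruct (IVT_gen (fun y => (m y - m' y)%R) (snd c) (snd c') 0) as (y & _ & Ey).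
  { apply continuity_minus; [apply Hm|apply Hm']. }
  { split.
    - apply Rle_trans with (m (snd c') - m' (snd c'))%R; [apply Rmin_r|lra].
    - apply Rle_trans with (m (snd c) - m' (snd c))%R; [lra|apply Rmax_l]. }
  destruct (midlines_meet L F F' a a' m m' y HF HF' Hm Hm' ltac:(lra)) as (n & n' & E).
  apply (Tie n n' E).
Qed.

Lemma parallel_to_1 (L : rhombic_lattice) (p q : C) :
  edge L p q -> parallel 1 (q - p) -> q = p + 1 \/ p = q + 1.
Proof.
  intros (i & Hi) Hp. pose proof (unit_sqr _ (side_unit _ _ _ Hi)) as U.
  assert (S : snd (q - p) = 0%R).
  { destruct Hp as (k & [E|E]).
    - assert (E1 := f_equal fst E). assert (E2 := f_equal snd E). simpl in *.
      assert (k <> 0)%R by (intros ->; lra).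
      apply (Rmult_eq_reg_l k); [lra|assumption].
    - rewrite E. simpl. ring. }
  rewrite S in U.
  assert (fst (q - p)%C = 1 \/ fst (q - p)%C = -1)%R as [E|E].
  { assert (K : ((fst (q - p)%C - 1) * (fst (q - p)%C + 1) = 0)%R) by lra.
    apply Rmult_integral in K. lra. }
  - left. apply C_eq; simpl in *; lra.
  - right. apply C_eq; simpl in *; lra.
Qed.

Lemma slanted_reaches_left_end (L : rhombic_lattice) (z : C) :
  coherent_tracks_on_both_sides L -> edge_direction L 1 -> is_vertex L z ->
  exists u, slanted_connected L z u /\ edge L u (u + 1).
Proof.
  intros Hboth (p & q & Hpq & E1) Hz.
  assert (Eq : q = p + 1) by (rewrite E1; ring). subst q. clear E1.
  (* Here the component of [z] contains the right end of an edge of direction 1. A walk along untied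
     edges leads from there to the left end of a tie of a coherent track; the first edge of
     direction 1 on the way must be entered at its left end. *)
  assert (Hright : forall b, slanted_connected L z (b + 1) -> edge L b (b + 1) ->
    exists u, slanted_connected L z u /\ edge L u (u + 1)).
  { intros b Hb He.
    destruct (horizontal_track_exists L b He) as (F & a & HF & E0).
    assert (Vb : is_vertex L (b + 1)) by apply (edge_vertices L b _ He).
    destruct (Hboth F (horizontal_track_is_track L F a HF) (Vertex L (b + 1) Vb))
      as (G & HG & Hcoh & Hside). simpl in Hside.
    assert (Hc : exists c, edge L c (c + 1) /\ track_side L F (b + 1) c).
    { destruct (HG 0%Z) as (x & y & _ & _ & Hsh & _ & _).
      destruct (Hside 0%Z x y ltac:(apply Hsh)) as (Hx & Hy & [Hxy _]).
      assert (Hpar : parallel 1 (y - x)).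
      { replace (RtoC 1) with (a 0%Z + 1 - a 0%Z) by ring.
        apply Hcoh; [apply (track_tie L F a HF)|exists 0%Z; exact Hsh]. }
      destruct (parallel_to_1 L x y Hxy Hpar) as [E|E].
      - exists x. rewrite <- E. auto.
      - exists y. rewrite <- E. split; [apply edge_sym, Hxy|exact Hy]. }
    destruct Hc as (c & Hc & Hbc). apply clos_rt_rt1n in Hbc.
    assert (Hwalk : forall u, clos_refl_trans_1n C (untied_edge L F) u c ->
      slanted_connected L z u -> exists u, slanted_connected L z u /\ edge L u (u + 1)).
    { intros u Hu. induction Hu as [u|u v w [Huv Nt] _ IH]; intros Hzu.
      - exists u. auto.
      - destruct (excluded_middle_informative (v = u + 1)) as [-> |N1].
        { exists u. auto. }
        destruct (excluded_middle_informative (u = v + 1)) as [-> |N2].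
        (* Entering at the right end gives a second track with the component on its right. By
           [facing_tracks] the edge would be a tie of [F]. *)
        { exfalso. destruct (horizontal_track_exists L v (edge_sym _ _ _ Huv))
            as (F' & a' & HF' & E0').
          destruct (facing_tracks L F F' a a' HF HF') as (n & E).
          { rewrite E0, E0'. apply rt_trans with z; [|exact Hzu].
            apply slanted_connected_sym, Hb. }
          apply Nt. rewrite <- E0', E.
          destruct (track_tie L F a HF n) as (k & K1 & K2 & K3).
          exists k. split; [exact K1|]. split; apply side_sym; assumption. }
        apply IH; [exact Hc|exact Hbc|]. apply rt_trans with u; [exact Hzu|]. apply rt_step.
        split; [exact Huv|]. split; intros E; [apply N1|apply N2]; rewrite <- E; ring. }
    apply (Hwalk (b + 1) Hbc Hb). }
  (* The first edge of direction 1 on a walk from [z] to [p] has its left end in the component or is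
     handled by [Hright]. If there is none, [p] is in the component. *)
  assert (Hwalk : forall u, clos_refl_trans_1n C (edge L) u p ->
    slanted_connected L z u -> exists u, slanted_connected L z u /\ edge L u (u + 1)).
  { intros u Hu. induction Hu as [u|u v w Huv _ IH]; intros Hzu.
    - exists u. auto.
    - destruct (excluded_middle_informative (v = u + 1)) as [-> |N1].
      { exists u. auto. }
      destruct (excluded_middle_informative (u = v + 1)) as [-> |N2].
      { apply (Hright v Hzu). apply edge_sym, Huv. }
      apply IH; [exact Hpq|]. apply rt_trans with u; [exact Hzu|]. apply rt_step.
      split; [exact Huv|]. split; intros E; [apply N1|apply N2]; rewrite <- E; ring. }
  apply (Hwalk z); [|apply rt_refl].
  apply clos_rt_rt1n, vertices_connected; [exact Hz|apply (edge_vertices L p _ Hpq)].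
Qed.

Lemma Zplus_kernel (L : rhombic_lattice) (o : vertex L) (h : vertex L -> C) :
  coherent_tracks_on_both_sides L -> edge_direction L 1 -> discrete_analytic L h ->
  (forall z, Zplus L o h z = 0) -> forall z, h z = 0.
Proof.
  intros Hboth Hdir Hh Hz.
  assert (Step : forall a b, edge L a b ->
    extend L h b * (1 - (b - a)) = extend L h a * (1 + (b - a))).
  { intros a b He. destruct (edge_vertices L a b He) as [Va Vb].
    pose proof (Zplus_step L o h (Vertex L a Va) (Vertex L b Vb) Hh He) as E.
    rewrite !Hz, <- !(extend_vertex L h) in E. simpl in E.
    transitivity (extend L h a * (1 + (b - a)) - 2 * ((extend L h a - extend L h b) / 2 +
      (extend L h a + extend L h b) / 2 * (b - a))); [field|].
    rewrite <- E. ring. }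
  (* If [h] vanishes at [v], then [h u * (1 + (v - u)) = 0], and this factor is 0 only for
     [u - v = 1]. *)
  assert (Slant : forall u v, slanted_connected L u v -> extend L h v = 0 -> extend L h u = 0).
  { intros u v H. induction H as [u v (He & N1 & N2)| |u v w _ IH1 _ IH2]; auto.
    intros Hv. pose proof (Step u v He) as E. rewrite Hv in E.
    destruct (excluded_middle_informative (extend L h u = 0)) as [|N]; [assumption|].
    exfalso. apply N2.
    replace (u - v) with (1 - (extend L h u * (1 + (v - u))) / extend L h u)
      by (field; exact N).
    rewrite <- E. unfold Cdiv. ring. }
  intros z. rewrite <- extend_vertex.
  destruct (slanted_reaches_left_end L z Hboth Hdir (point_is_vertex L z)) as (u & Hu & He).
  apply (Slant z u Hu). pose proof (Step u (u + 1) He) as E.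
  (* For an edge of direction 1 the recursion reads [0 = 2 * h u]. *)
  replace (extend L h u) with (extend L h u * (1 + (u + 1 - u)) / 2) by field.
  rewrite <- E. field.
Qed.

(** * Complex power series *)

Notation is_Cpseries := (is_pseries (K := C_AbsRing) (V := C_NormedModule)).

Lemma Cmod_pow_n (t : C) (n : nat) : Cmod (pow_n (K := C_AbsRing) t n) = (Cmod t ^ n)%R.
Proof.
  induction n as [|n IH].
  - apply Cmod_1.
  - change (pow_n (K := C_AbsRing) t (S n)) with (t * pow_n (K := C_AbsRing) t n).
    rewrite Cmod_mult, IH. reflexivity.
Qed.

(** Radius of convergence at least 1, expressed by bounded partial sums so that the recurrence can
    be estimated without limits. *)
Definition abs_summable (a : nat -> C) : Prop :=
  forall r, (0 <= r < 1)%R -> exists M, forall N,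
    (sum_n (fun n => Cmod (a n) * r ^ n) N <= M)%R.

(** For generating functions the recurrence reads [(1 + k * t) * B = (1 + k' * t) * A]. Each partial
    sum for [b] is at most [2 * M] plus [r] times the previous one, so all stay below the fixed
    point [2 * M / (1 - r)]. *)
Lemma abs_summable_recurrence (a b : nat -> C) (k k' : C) :
  (Cmod k <= 1)%R -> (Cmod k' <= 1)%R -> b O = a O ->
  (forall n, b (S n) = a (S n) + (k' * a n - k * b n)) ->
  abs_summable a -> abs_summable b.
Proof.
  intros Hk Hk' H0 HS Ha r Hr. destruct (Ha r Hr) as (M & HM).
  set (x := fun n => (Cmod (a n) * r ^ n)%R) in *.
  set (y := fun n => (Cmod (b n) * r ^ n)%R).
  assert (Hx : forall n, (0 <= x n)%R).
  { intros n. apply Rmult_le_pos; [apply Cmod_ge_0|apply pow_le; lra]. }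
  assert (Hy : forall n, (0 <= y n)%R).
  { intros n. apply Rmult_le_pos; [apply Cmod_ge_0|apply pow_le; lra]. }
  assert (Hxy : forall n, (y (S n) <= x (S n) + r * x n + r * y n)%R).
  { intros n. unfold x, y. rewrite HS.
    pose proof (Cmod_triangle (a (S n)) (k' * a n - k * b n)) as T1.
    pose proof (Cmod_triangle (k' * a n) (- (k * b n))) as T2.
    rewrite Cmod_opp, !Cmod_mult in T2.
    change (k' * a n + - (k * b n)) with (k' * a n - k * b n) in T2.
    pose proof (Cmod_ge_0 (a n)). pose proof (Cmod_ge_0 (b n)).
    assert (Hp : (0 <= r ^ n)%R) by (apply pow_le; lra).
    assert (T : (Cmod (a (S n) + (k' * a n - k * b n)) <=
      Cmod (a (S n)) + Cmod (a n) + Cmod (b n))%R) by nra.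
    apply (Rmult_le_compat_r (r * r ^ n)) in T; [|nra]. simpl pow. lra. }
  assert (HB : forall N, (sum_n y (S N) <= sum_n x (S N) + r * sum_n x N + r * sum_n y N)%R).
  { induction N as [|N IH].
    - rewrite !sum_Sn, !sum_O. unfold plus; simpl.
      assert (y O = x O) by (unfold x, y; rewrite H0; reflexivity).
      pose proof (Hxy O). lra.
    - rewrite (sum_Sn y (S N)), (sum_Sn x (S N)).
      rewrite (sum_Sn x N) at 2. rewrite (sum_Sn y N) at 2.
      unfold plus in *; simpl in *. pose proof (Hxy (S N)).
      rewrite !Rmult_plus_distr_l. lra. }
  assert (HM0 : (0 <= M)%R).
  { specialize (HM O). rewrite sum_O in HM. specialize (Hx O). lra. }
  exists (2 * M / (1 - r))%R. intros N.
  assert (E : (2 * M / (1 - r) = 2 * M + r * (2 * M / (1 - r)))%R) by (field; lra).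
  assert (Hpos : (2 * M <= 2 * M / (1 - r))%R).
  { rewrite E. assert (0 <= 2 * M / (1 - r))%R; [|nra].
    apply Rmult_le_pos; [lra|]. apply Rlt_le, Rinv_0_lt_compat. lra. }
  induction N as [|N IH].
  - fold y. pose proof (HM O) as H. rewrite sum_O in *.
    assert (y O = x O) by (unfold x, y; rewrite H0; reflexivity). lra.
  - fold y in IH |- *. pose proof (HB N). pose proof (HM (S N)). pose proof (HM N).
    rewrite E. nra.
Qed.

Lemma abs_summable_ex_series (a : nat -> C) (r : R) :
  abs_summable a -> (0 <= r < 1)%R -> ex_series (fun n => Cmod (a n) * r ^ n)%R.
Proof.
  intros Ha Hr. destruct (Ha r Hr) as (M & HM).
  destruct (ex_finite_lim_seq_incr (sum_n (fun n => Cmod (a n) * r ^ n)%R) M) as (l & Hl).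
  - intros n. rewrite sum_Sn. unfold plus; simpl.
    assert (0 <= Cmod (a (S n)) * r ^ (S n))%R
      by (apply Rmult_le_pos; [apply Cmod_ge_0|apply pow_le; lra]).
    simpl in *. lra.
  - exact HM.
  - exists l. exact Hl.
Qed.

Lemma abs_summable_ex_pseries (a : nat -> C) (t : C) :
  abs_summable a -> (Cmod t < 1)%R -> exists s, is_Cpseries a t s.
Proof.
  intros Ha Ht.
  apply (ex_series_le (V := C_CompleteNormedModule)
    (fun k => scal (pow_n (K := C_AbsRing) t k) (a k)) (fun n => Cmod (a n) * Cmod t ^ n)%R).
  - intros n. change (Cmod (pow_n (K := C_AbsRing) t n * a n) <= Cmod (a n) * Cmod t ^ n)%R.
    rewrite Cmod_mult, Cmod_pow_n. lra.
  - apply abs_summable_ex_series; [exact Ha|]. split; [apply Cmod_ge_0|exact Ht].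
Qed.

Lemma Cpseries_value_unique (a : nat -> C) (t s s' : C) :
  is_Cpseries a t s -> is_Cpseries a t s' -> s = s'.
Proof. apply filterlim_locally_unique. Qed.

Lemma Cpseries_affine (a : nat -> C) (t s c d : C) :
  is_Cpseries a t s ->
  is_Cpseries (fun n => c * a n + d * match n with O => 0 | S m => a m end) t
    ((c + t * d) * s).
Proof.
  intros H.
  replace ((c + t * d) * s) with (plus (scal c s) (scal d (scal t s)) : C_NormedModule)
    by (unfold plus, scal; simpl; unfold mult; simpl; ring).
  apply (is_pseries_plus (K := C_AbsRing) (V := C_NormedModule)
    (PS_scal c a) (PS_scal d (PS_incr_1 a)) t).
  - exact (is_pseries_scal (K := C_AbsRing) (V := C_NormedModule) c a t s (Cmult_comm t c) H).
  - exact (is_pseries_scal (K := C_AbsRing) (V := C_NormedModule) d (PS_incr_1 a) t _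
      (Cmult_comm t d) (is_pseries_incr_1 (V := C_NormedModule) a t s H)).
Qed.

(** [p] stands for the real or the imaginary part. *)
Lemma is_series_component (p : C -> R) (a : nat -> C) (s : C) :
  (forall x y, p (x + y) = (p x + p y)%R) ->
  filterlim p (locally (T := C_UniformSpace) s) (locally (p s)) ->
  is_series (K := C_AbsRing) (V := C_NormedModule) a s ->
  is_series (fun n => p (a n)) (p s).
Proof.
  intros Hp Hc Hs. unfold is_series in *.
  apply (filterlim_ext (fun N => p (sum_n (G := C_AbelianMonoid) a N))).
  - intros N. induction N as [|N IH].
    + rewrite !sum_O. reflexivity.
    + rewrite !sum_Sn, <- IH. apply Hp.
  - eapply filterlim_comp; [exact Hs|exact Hc].
Qed.

(** Convergence at 1/2 makes both radii positive, so equal sums near 0 determine the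
    coefficients. *)
Lemma pseries_coef_unique (a b : nat -> R) (s : R -> R) :
  (forall t, (Rabs t < 1)%R -> is_pseries a t (s t)) ->
  (forall t, (Rabs t < 1)%R -> is_pseries b t (s t)) -> forall n, a n = b n.
Proof.
  intros Ha Hb n.
  assert (Hr : forall c : nat -> R, (forall t, (Rabs t < 1)%R -> is_pseries c t (s t)) ->
    Rbar_lt 0 (CV_radius c)).
  { intros c Hc. apply Rbar_lt_le_trans with (Finite (1 / 2)); [simpl; lra|].
    apply Rbar_not_lt_le. intros Hlt.
    assert (Eh : Rabs (1 / 2) = (1 / 2)%R) by (apply Rabs_right; lra).
    rewrite <- Eh in Hlt. apply CV_disk_outside in Hlt. apply Hlt.
    apply (is_lim_seq_ext (fun k => scal (pow_n (K := R_AbsRing) (1 / 2)%R k) (c k))).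
    - intros k. rewrite pow_n_pow. apply Rmult_comm.
    - apply ex_series_lim_0. exists (s (1 / 2)%R). apply Hc. lra. }
  apply PSeries_ext_recip; [apply Hr, Ha|apply Hr, Hb|].
  exists (mkposreal 1 Rlt_0_1). intros t Ht.
  assert (Ht' : (Rabs t < 1)%R).
  { change (Rabs (t - 0) < 1)%R in Ht. rewrite Rminus_0_r in Ht. exact Ht. }
  rewrite (is_pseries_unique _ _ _ (Ha t Ht')), (is_pseries_unique _ _ _ (Hb t Ht')).
  reflexivity.
Qed.

Lemma Cpseries_real_point (p : C -> R) (a : nat -> C) (t : R) (s : C) :
  (forall x y, p (x + y) = (p x + p y)%R) -> (forall (r : R) x, p (r * x) = (r * p x)%R) ->
  filterlim p (locally (T := C_UniformSpace) s) (locally (p s)) ->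
  is_Cpseries a (RtoC t) s -> is_pseries (fun n => p (a n)) t (p s).
Proof.
  intros Hadd Hscal Hc Hs.
  apply (is_series_ext (fun n =>
    p (scal (V := C_NormedModule) (pow_n (K := C_AbsRing) (RtoC t) n) (a n)))).
  - intros n.
    assert (E : pow_n (K := C_AbsRing) (RtoC t) n = RtoC (pow_n (K := R_AbsRing) t n)).
    { induction n as [|n IH]; [reflexivity|].
      change (RtoC t * pow_n (K := C_AbsRing) (RtoC t) n =
        RtoC (t * pow_n (K := R_AbsRing) t n)%R).
      rewrite IH, RtoC_mult. reflexivity. }
    rewrite E. apply Hscal.
  - apply is_series_component; assumption.
Qed.

(** Real points of the disk suffice: there the real and imaginary parts are real power series. *)
Lemma Cpseries_coef_unique (a b : nat -> C) (s : C -> C) :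
  (forall t, (Cmod t < 1)%R -> is_Cpseries a t (s t)) ->
  (forall t, (Cmod t < 1)%R -> is_Cpseries b t (s t)) -> forall n, a n = b n.
Proof.
  intros Ha Hb n.
  assert (Hre : forall c : nat -> C, (forall t, (Cmod t < 1)%R -> is_Cpseries c t (s t)) ->
    forall t, (Rabs t < 1)%R ->
    is_pseries (fun n => fst (c n)) t (fst (s t)) /\
    is_pseries (fun n => snd (c n)) t (snd (s t))).
  { intros c Hc t Ht. rewrite <- Cmod_R in Ht. split.
    - apply (Cpseries_real_point fst); [reflexivity|intros; simpl; ring| |apply Hc, Ht].
      apply (continuous_fst (U := R_UniformSpace) (V := R_UniformSpace)).
    - apply (Cpseries_real_point snd); [reflexivity|intros; simpl; ring| |apply Hc, Ht].
      apply (continuous_snd (U := R_UniformSpace) (V := R_UniformSpace)). }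
  apply C_eq.
  - exact (pseries_coef_unique (fun n => fst (a n)) (fun n => fst (b n))
      (fun t : R => fst (s (RtoC t))) (fun t Ht => proj1 (Hre a Ha t Ht))
      (fun t Ht => proj1 (Hre b Hb t Ht)) n).
  - exact (pseries_coef_unique (fun n => snd (a n)) (fun n => snd (b n))
      (fun t : R => snd (s (RtoC t))) (fun t Ht => proj2 (Hre a Ha t Ht))
      (fun t Ht => proj2 (Hre b Hb t Ht)) n).
Qed.

Lemma nth_root_le (n : nat) (x y : R) :
  (1 <= n)%nat -> (0 <= x)%R -> (0 < y)%R -> (x <= y ^ n)%R -> (nth_root n x <= y)%R.
Proof.
  intros Hn Hx Hy H. unfold nth_root. destruct (Req_EM_T x 0) as [_|N]; [lra|].
  assert (Hn' : (0 < INR n)%R) by (apply lt_0_INR; lia).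
  apply Rle_trans with (Rpower (y ^ n) (/ INR n)).
  - apply Rle_Rpower_l; [|lra]. apply Rlt_le, Rinv_0_lt_compat, Hn'.
  - rewrite <- Rpower_pow by exact Hy. rewrite Rpower_mult, Rinv_r by lra.
    rewrite Rpower_1 by exact Hy. lra.
Qed.

(** For each [r] between 0 and 1 the terms [Cmod (a n) * r ^ n] tend to 0, so the roots are
    eventually at most [/ r]. *)
Lemma abs_summable_root (a : nat -> C) :
  abs_summable a -> Rbar_le (LimSup_seq (fun n => nth_root n (Cmod (a n)))) 1%R.
Proof.
  intros Ha.
  assert (K : forall r, (0 < r < 1)%R ->
    Rbar_le (LimSup_seq (fun n => nth_root n (Cmod (a n)))) (/ r)%R).
  { intros r Hr. rewrite <- (LimSup_seq_const (/ r)). apply LimSup_le.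
    assert (Hs : ex_series (fun n => Cmod (a n) * r ^ n)%R)
      by (apply abs_summable_ex_series; [exact Ha|lra]).
    apply ex_series_lim_0, is_lim_seq_spec in Hs.
    destruct (Hs (mkposreal 1 Rlt_0_1)) as (N & HN). exists (S N). intros n Hn.
    specialize (HN n ltac:(lia)). simpl in HN. rewrite Rminus_0_r in HN.
    apply Rabs_def2 in HN.
    assert (Hp : (0 < r ^ n)%R) by (apply pow_lt; lra).
    apply nth_root_le; [lia|apply Cmod_ge_0|apply Rinv_0_lt_compat; lra|].
    rewrite pow_inv. apply (Rmult_le_reg_r (r ^ n)); [exact Hp|].
    rewrite Rinv_l; lra. }
  destruct (LimSup_seq (fun n => nth_root n (Cmod (a n)))) as [x| |]; simpl in *.
  - apply Rnot_lt_le. intros Hx.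
    (* For [x > 1] this [r] is less than 1, while [r * x = 2 - r] exceeds 1. *)
    set (r := (2 / (1 + x))%R).
    assert (Hrx : (r * (1 + x) = 2)%R) by (unfold r; field; lra).
    assert (Hr : (0 < r < 1)%R) by (split; nra).
    specialize (K r Hr).
    assert (r * x <= 1)%R; [|nra].
    apply (Rmult_le_compat_l r) in K; [|lra]. rewrite Rinv_r in K; lra.
  - apply (K (1 / 2)%R). lra.
  - exact I.
Qed.

(** * The discrete exponential *)

Lemma edge_Cmod (L : rhombic_lattice) (a b : C) : edge L a b -> Cmod (b - a) = 1%R.
Proof. intros (i & Hi). apply (side_unit _ _ _ Hi). Qed.

Lemma half_bound (e : C) : Cmod e = 1%R -> (Cmod ((1 + e) / 2) <= 1)%R.
Proof.
  intros He. rewrite Cmod_div by (intros E; apply RtoC_inj in E; lra).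
  rewrite Cmod_R, (Rabs_right 2) by lra.
  pose proof (Cmod_triangle 1 e) as T. rewrite Cmod_1, He in T. lra.
Qed.

Lemma discrete_power_origin (L : rhombic_lattice) (o : vertex L) (n : nat) :
  discrete_power L o (S n) o = 0.
Proof. apply Zplus_origin, discrete_power_analytic. Qed.

Lemma discrete_power_step (L : rhombic_lattice) (o a b : vertex L) (n : nat) :
  edge L a b ->
  discrete_power L o (S n) b = discrete_power L o (S n) a +
    ((1 + (b - a)) / 2 * discrete_power L o n a - (1 + - (b - a)) / 2 * discrete_power L o n b).
Proof.
  intros He. simpl.
  pose proof (Zplus_step L o _ a b (discrete_power_analytic L o n) He) as E.
  set (x := discrete_power L o n) in *.
  replace (Zplus L o x b) with ((Zplus L o x b - Zplus L o x a) + Zplus L o x a) by ring.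
  rewrite E. field.
Qed.

(** At the origin only the term with [n = 0] is nonzero, and absolute summability passes along edges
    by the recursion. *)
Lemma discrete_power_summable (L : rhombic_lattice) (o z : vertex L) :
  abs_summable (fun n => discrete_power L o n z).
Proof.
  assert (K : forall l a b, is_path L a l b ->
    abs_summable (fun n => discrete_power L o n a) ->
    abs_summable (fun n => discrete_power L o n b)).
  { induction l as [|v l IH]; intros a b Hl Ha; simpl in Hl.
    - subst b. exact Ha.
    - destruct Hl as [He Hl]. apply (IH v b Hl).
      apply (abs_summable_recurrence (fun n => discrete_power L o n a) _
        ((1 + - (v - a)) / 2) ((1 + (v - a)) / 2)).
      + apply half_bound. rewrite Cmod_opp. apply (edge_Cmod L), He.
      + apply half_bound, (edge_Cmod L), He.
      + reflexivity.
      + intros n. apply discrete_power_step, He.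
      + exact Ha. }
  destruct (path_exists L o z) as (l & Hl). apply (K l o z Hl).
  intros r _. exists 1%R. induction N as [|N IH].
  - rewrite sum_O. simpl. rewrite Cmod_1. lra.
  - rewrite sum_Sn, discrete_power_origin, Cmod_0, Rmult_0_l. unfold plus; simpl. lra.
Qed.

Lemma denominator_neq_0 (t e : C) :
  (Cmod t < 1)%R -> Cmod e = 1%R -> 2 + t * (1 + e) <> 0.
Proof.
  intros Ht He E.
  assert (E' : RtoC (- 2)%R = t * (1 + e)).
  { transitivity (t * (1 + e) - (2 + t * (1 + e))).
    - apply C_eq; simpl; ring.
    - rewrite E. ring. }
  apply (f_equal Cmod) in E'. rewrite Cmod_mult, Cmod_R, Rabs_left in E' by lra.
  pose proof (Cmod_triangle 1 e) as T. rewrite Cmod_1, He in T.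
  pose proof (Cmod_ge_0 t). pose proof (Cmod_ge_0 (1 + e)). nra.
Qed.

Lemma discrete_power_exp (L : rhombic_lattice) (o z : vertex L) (t : C) :
  (Cmod t < 1)%R -> is_Cpseries (fun n => discrete_power L o n z) t (discrete_exp L o t z).
Proof.
  intros Ht.
  set (E := (fun v => proj1_sig (constructive_indefinite_description _
    (abs_summable_ex_pseries _ t (discrete_power_summable L o v) Ht))) : vertex L -> C).
  assert (HE : forall v, is_Cpseries (fun n => discrete_power L o n v) t (E v)).
  { intros v. exact (proj2_sig (constructive_indefinite_description _
    (abs_summable_ex_pseries _ t (discrete_power_summable L o v) Ht))). }
  clearbody E.
  (* Both sides are sums of the same power series, by the recursion of the discrete powers along the
     edge. *)
  assert (Step : forall a b : vertex L, edge L a b ->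
    (2 + t * (1 + a - b)) * E b = (2 + t * (1 + b - a)) * E a).
  { intros a b He.
    apply (Cpseries_value_unique (fun n => 2 * discrete_power L o n b + (1 + a - b) *
      match n with O => 0 | S m => discrete_power L o m b end) t).
    - apply Cpseries_affine, HE.
    - replace (fun n => 2 * discrete_power L o n b + (1 + a - b) *
        match n with O => 0 | S m => discrete_power L o m b end) with
       (fun n => 2 * discrete_power L o n a + (1 + b - a) *
        match n with O => 0 | S m => discrete_power L o m a end).
      + apply Cpseries_affine, HE.
      + apply functional_extensionality. intros [|n]; [simpl; ring|].
        rewrite (discrete_power_step L o a b n He). field. }
  assert (Eo : E o = 1).
  { apply (Cpseries_value_unique (fun n => discrete_power L o n o) t _ _ (HE o)).
    unfold is_pseries, is_series.
    apply (filterlim_ext (fun _ => RtoC 1)).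
    - intros N. induction N as [|N IH].
      + rewrite sum_O. simpl. unfold scal; simpl. unfold mult, one; simpl. ring.
      + rewrite sum_Sn, <- IH, discrete_power_origin. unfold plus, scal; simpl.
        unfold mult; simpl. ring.
    - apply filterlim_const. }
  assert (K : forall l a b, is_path L a l b -> exp_product L t a l * E a = E b).
  { induction l as [|v l IH]; intros a b Hl; simpl in *.
    - subst b. ring.
    - destruct Hl as [He Hl]. rewrite <- (IH v b Hl).
      assert (N : 2 + t * (1 + a - v) <> 0).
      { replace (1 + a - v) with (1 + - (v - a)) by ring.
        apply denominator_neq_0; [exact Ht|].
        rewrite Cmod_opp. apply (edge_Cmod L), He. }
      transitivity (exp_product L t v l * ((2 + t * (1 + v - a)) * E a) / (2 + t * (1 + a - v))).
      + field. exact N.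
      + rewrite <- (Step a v He). field. exact N. }
  replace (discrete_exp L o t z) with (E z); [apply HE|].
  symmetry. apply along_any_path_spec. intros l Hl.
  rewrite <- (K l o z Hl), Eo. ring.
Qed.

(** [h] shows that the specification behind [epsilon] can be met, and the trivial kernel of [Zplus]
    makes the chosen function equal to [h]. *)
Lemma Zminus_of_Zplus (L : rhombic_lattice) (o : vertex L) (g h : vertex L -> C) :
  coherent_tracks_on_both_sides L -> edge_direction L 1 -> discrete_analytic L h ->
  (forall z, Zplus L o h z = g z - g o) -> forall z, Zminus L o g z = h z.
Proof.
  intros Hboth Hdir Hh Hg z.
  pose proof (epsilon_spec (inhabits (fun _ : vertex L => RtoC 0))
    (fun h : vertex L -> C => discrete_analytic L h /\
       forall z : vertex L, Zplus L o h z = g z - g o) (ex_intro _ h (conj Hh Hg))) as [H1 H2].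
  fold (Zminus L o g) in H1, H2. set (k := Zminus L o g) in *.
  assert (E : forall z, -1 * h z + k z = 0).
  { apply (Zplus_kernel L o); try assumption.
    - apply discrete_analytic_lin; assumption.
    - intros v. rewrite Zplus_lin by assumption. rewrite Hg, H2. ring. }
  specialize (E z). replace (k z) with (-1 * h z + k z + h z) by ring.
  rewrite E. ring.
Qed.

(** * Linear independence of the discrete powers *)

Definition combination (L : rhombic_lattice) (o : vertex L) (c : nat -> C) (N : nat)
  (z : vertex L) : C := sum_n (G := C_AbelianMonoid) (fun n => c n * discrete_power L o n z) N.

Lemma combination_succ (L : rhombic_lattice) (o : vertex L) (c : nat -> C) (N : nat) :
  combination L o c (S N) =
  (fun z => c (S N) * discrete_power L o (S N) z + combination L o c N z).
Proof.
  apply functional_extensionality. intros z. unfold combination. rewrite sum_Sn.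
  unfold plus; simpl. ring.
Qed.

Lemma combination_0 (L : rhombic_lattice) (o : vertex L) (c : nat -> C) :
  combination L o c 0 = (fun _ => c O).
Proof.
  apply functional_extensionality. intros z. unfold combination. rewrite sum_O. simpl. ring.
Qed.

Lemma combination_analytic (L : rhombic_lattice) (o : vertex L) (c : nat -> C) (N : nat) :
  discrete_analytic L (combination L o c N).
Proof.
  induction N as [|N IH].
  - rewrite combination_0. apply discrete_analytic_const.
  - rewrite combination_succ. apply discrete_analytic_lin; [apply discrete_power_analytic|exact IH].
Qed.

(** The shift raises each discrete power by one, so all terms but the constant one form an image
    under [Zplus]. *)
Lemma combination_Zplus (L : rhombic_lattice) (o z : vertex L) (c : nat -> C) (N : nat) :
  combination L o c (S N) z = c O + Zplus L o (combination L o (fun n => c (S n)) N) z.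
Proof.
  induction N as [|N IH].
  - rewrite combination_succ, !combination_0.
    assert (E : (fun _ : vertex L => c 1%nat) =
      (fun v => c 1%nat * discrete_power L o 0 v + (fun _ => 0) v)).
    { apply functional_extensionality. intros v. simpl. ring. }
    rewrite E, Zplus_lin
      by first [apply (discrete_power_analytic L o 0) | apply discrete_analytic_const].
    rewrite (Zplus_unique L o (fun _ => 0) (fun _ => 0)).
    + simpl. ring.
    + apply discrete_analytic_const.
    + reflexivity.
    + intros. field.
  - rewrite combination_succ, IH, (combination_succ L o (fun n => c (S n))), Zplus_lin.
    + simpl. ring.
    + apply discrete_power_analytic.
    + apply combination_analytic.
Qed.

Lemma combination_origin (L : rhombic_lattice) (o : vertex L) (c : nat -> C) (N : nat) :
  combination L o c N o = c O.
Proof.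
  induction N as [|N IH].
  - rewrite combination_0. reflexivity.
  - rewrite combination_succ, discrete_power_origin, IH. ring.
Qed.

(** Evaluation at the origin shows that the constant coefficient is 0. The rest is a vanishing image
    under [Zplus], and injectivity reduces it to a shorter combination. *)
Lemma discrete_powers_independent (L : rhombic_lattice) (o : vertex L) :
  coherent_tracks_on_both_sides L -> edge_direction L 1 ->
  linearly_independent (vertex L) (discrete_power L o).
Proof.
  intros Hboth Hdir N. induction N as [|N IH]; intros c Hc n Hn.
  - replace n with O by lia. rewrite <- (combination_origin L o c 0). apply Hc.
  - assert (E0 : c O = 0).
    { rewrite <- (combination_origin L o c (S N)). apply Hc. }
    destruct n as [|n]; [exact E0|].
    apply (IH (fun n => c (S n))); [|lia].
    apply (Zplus_kernel L o _ Hboth Hdir); [apply combination_analytic|].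
    intros z. pose proof (combination_Zplus L o z c N) as E.
    unfold combination in E at 1. rewrite Hc, E0, Cplus_0_l in E. symmetry. exact E.
Qed.

Theorem proposition2p3 (L : rhombic_lattice) (o : vertex L)
  (o_zero : point L o = RtoC 0)
  (one_direction : edge_direction L (RtoC 1))
  (both_sides : coherent_tracks_on_both_sides L) :
  (exists zpow : nat -> vertex L -> C, taylor_coefficients L o zpow) /\
  forall zpow : nat -> vertex L -> C, taylor_coefficients L o zpow ->
    (forall n : nat, discrete_analytic L (zpow n)) /\
    (forall z : vertex L, zpow 0%nat z = RtoC 1) /\
    (forall (n : nat) (z : vertex L), (1 <= n)%nat ->
       zpow n z = Zplus L o (zpow (n - 1)%nat) z) /\
    (forall z : vertex L, zpow 1%nat z = point L z) /\
    (forall z : vertex L, Zminus L o (zpow 0%nat) z = RtoC 0) /\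
    (forall (n : nat) (z : vertex L), (1 <= n)%nat ->
       Zminus L o (zpow n) z = zpow (n - 1)%nat z) /\
    (forall z : vertex L,
       Rbar_le
         (LimSup_seq (fun n : nat => nth_root n (Cmod (zpow n z))))
         (Finite 1)) /\
    linearly_independent (vertex L) zpow.
Proof.
  assert (Htaylor : taylor_coefficients L o (discrete_power L o)).
  { intros t z Ht. apply discrete_power_exp, Ht. }
  split; [exists (discrete_power L o); exact Htaylor|].
  intros zpow Hz.
  (* Taylor coefficients in the disk are unique, so all claims reduce to the discrete powers. *)
  assert (E : zpow = discrete_power L o).
  { apply functional_extensionality. intros n. apply functional_extensionality. intros z.
    apply (Cpseries_coef_unique (fun n => zpow n z) (fun n => discrete_power L o n z)
      (fun t => discrete_exp L o t z)); intros t Ht; [apply Hz|apply Htaylor]; exact Ht. }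
  rewrite E. clear zpow Hz E.
  split; [apply discrete_power_analytic|].
  split; [reflexivity|].
  split; [intros [|n] z Hn; [lia|]; simpl; rewrite Nat.sub_0_r; reflexivity|].
  split; [intros z; apply discrete_power_1, o_zero|].
  split; [|split; [|split]].
  (* The preimage is the zero function, since a constant minus its value at the origin vanishes. *)
  - apply Zminus_of_Zplus; [exact both_sides|exact one_direction
                           |apply discrete_analytic_const|].
    apply Zplus_unique; [apply discrete_analytic_const|simpl; ring|].
    intros a b _. simpl. field.
  - intros [|n] z Hn; [lia|].
    replace (S n - 1)%nat with n by lia. revert z.
    apply Zminus_of_Zplus; [exact both_sides|exact one_direction
                           |apply discrete_power_analytic|].
    intros z. rewrite discrete_power_origin. simpl. ring.
  - intros z. apply abs_summable_root, discrete_power_summable.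
  - apply discrete_powers_independent; assumption.
Qed.
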